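(* There exists a universal constant $c>0$ such that the following holds. Let $n\ge 2$ and $t\ge 1$ be integers with $t\leq c\,\frac{n}{\log n}$. Let $F,G\subset S_n$ be families of permutations of $[n]$ such that for all $\sigma\in F$ and $\tau\in G$, $|\{i\in[n]:\sigma(i)=\tau(i)\}|\neq t-1$. If \[ |F||G|>\left(1-\frac{1}{(100t)^t}\right)\cdot\big((n-t)!\big)^2, \] then there exist pairwise distinct $i_1,\ldots,i_t\in[n]$ and pairwise distinct $j_1,\ldots,j_t\in[n]$ such that both $F$ and $G$ are contained in $\{\sigma\in S_n:\sigma(i_1)=j_1,\ldots,\sigma(i_t)=j_t\}$.
   Context: $[n]=\{1,\ldots,n\}$ and $S_n$ is the set of all permutations of $[n]$. *)

(* Defs.v *)
From mathcomp Require Import all_boot all_fingroup.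

Set Implicit Arguments.
Unset Strict Implicit.
Unset Printing Implicit Defensive.

Definition agreement (n : nat) (s u : {perm 'I_n}) : {set 'I_n} :=
  [set i | s i == u i].

Definition pinned_perms (n t : nat) (i j : 'I_t -> 'I_n) : {set {perm 'I_n}} :=
  [set s : {perm 'I_n} | [forall k, s (i k) == j k]].

(* Main.v *)
Require Import Defs.
From mathcomp Require Import all_boot all_order all_algebra all_fingroup.
From mathcomp Require Import reals sequences exp.
From mathcomp Require Import zify ring lra.

Set Implicit Arguments.
Unset Strict Implicit.
Unset Printing Implicit Defensive.
Import Order.TTheory GRing.Theory Num.Theory.
Local Open Scope ring_scope.

(** Fixing a set [A] of points of the graph that maximises the density of [F] above
    [A], divided by [r ^ #|A|], makes the restriction of [F] to [A] global: no
    further set [D] of points multiplies its density by more than [r ^ #|D|].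

    For [r] close to 1 a second moment computation finds a disjoint pair in two
    global families: disjointness on rows is a product of kernels [1 - rho * Z]
    with [Z] positive semidefinite, so it is controlled by the diagonal forms of
    the product of [1 + rho * Z], that is, by exponential moments of the number of
    agreements.  Adding common points one at a time, and making the families global
    again after each addition, yields pairs with any prescribed number of agreements.
    Hence restrictions of cross-avoiding families that are not too small must share
    at least [t] points.

    At the coarse scale [r] of order [n / ln n] the maximal sets [A] of [F] and [B]
    of [G] bound the sizes: a permutation of [F] meets [B] in [t] points, up to
    parts whose product with [G] is negligible, so [#|F| * #|G|] is far below
    [(n - t)!^2] unless [A = B] has size [t].  Then almost all of [F] and [G] lies
    above [A], and a single permutation outside would exclude from the other family
    more permutations than the hypothesis allows. *)

(** * Families of permutations through a partial permutation *)

Section Families.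
Context (n : nat).
Implicit Types (s u : {perm 'I_n}) (F G : {set {perm 'I_n}}).
Implicit Types (A B D : {set 'I_n * 'I_n}).

(** Only the value t - 1 is forbidden, so a large number of agreements is no contradiction in
    itself: agreements have to be steered to t - 1 from below. Hence the maximal sets must share
    fewer than t points before common points are added, and every thinning step has to control
    accidental common points.

    Two scales are needed because their demands conflict. The second moment bound is about exp (r -
    1) and must stay below 2, which r = 5/4 satisfies; but at that scale maximal sets may have order
    t log n points, too many for an efficient cover.

    The condition t <= c n / log n enters twice: order t log n points at the fine scale must fit
    into n / 1000, and 6t must fit into q / 10.

    The deficit 1 / (100 t)^t comes from a count: above a core of t points, at least (n - t)! / (6
    (2t)^t) permutations agree exactly t - 1 times with a given permutation not containing the core.
    Since 50^t >= 48, this is 8 times the deficit. *)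

Definition gr s : {set 'I_n * 'I_n} := [set p | s p.1 == p.2].

Definition fam F A : {set {perm 'I_n}} := [set s in F | A \subset gr s].

Lemma mem_gr s i j : ((i, j) \in gr s) = (s i == j).
Proof. by rewrite inE. Qed.

Lemma card_agreement s u : #|agreement s u| = #|gr s :&: gr u|.
Proof.
have -> : gr s :&: gr u = (fun i => (i, s i)) @: agreement s u.
  apply/setP => -[i j]; rewrite !inE /=; apply/andP/imsetP => [[/eqP sj /eqP uj]|].
    by exists i; rewrite ?inE sj ?uj.
  by case=> k; rewrite inE => /eqP sk [-> ->]; rewrite sk eqxx.
by rewrite card_imset // => i j [].
Qed.

Lemma card_dom A s : A \subset gr s -> #|fst @: A| = #|A|.
Proof.
move=> /subsetP As; apply: card_in_imset => -[i j] [k l] /As + /As.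
by rewrite !inE /= => /eqP <- /eqP <- ->.
Qed.

Lemma card_codom A s : A \subset gr s -> #|snd @: A| = #|A|.
Proof.
move=> /subsetP As; apply: card_in_imset => -[i j] [k l] /As + /As.
by rewrite !inE /= => /eqP <- /eqP <- /perm_inj ->.
Qed.

Lemma card_sub_gr A s : A \subset gr s -> (#|A| <= n)%N.
Proof. by move=> /card_dom <-; rewrite -[leqRHS]card_ord max_card. Qed.

Lemma fam_sub F A : fam F A \subset F.
Proof. by apply/subsetP => s; rewrite inE => /andP[]. Qed.

Lemma famU F A B : fam (fam F A) B = fam F (A :|: B).
Proof. by apply/setP => s; rewrite !inE subUset andbA. Qed.

Lemma fam_id F A : (forall s, s \in F -> A \subset gr s) -> fam F A = F.
Proof.
move=> FA; apply/setP => s; rewrite inE.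
by case: (boolP (s \in F)) => // /FA ->.
Qed.

Lemma famS F G A : F \subset G -> fam F A \subset fam G A.
Proof.
by move=> /subsetP FG; apply/subsetP => s; rewrite !inE => /andP[/FG -> ->].
Qed.

Lemma fam0 F : fam F set0 = F.
Proof. by apply: fam_id => s _; rewrite sub0set. Qed.

Lemma mem_fam F A s : s \in fam F A -> (s \in F) /\ (A \subset gr s).
Proof. by rewrite inE => /andP[]. Qed.

(** Right multiplication by [s] carries the permutations that fix every row of [A] onto those
    through [A]. *)
Lemma card_famT A s : A \subset gr s -> #|fam setT A| = (n - #|A|)`!.
Proof.
move=> As; have As' := subsetP As.
have -> : fam setT A = (mulg^~ s) @: [set u | perm_on (~: (fst @: A)) u].
  apply/setP => u; rewrite !inE /=; apply/idP/imsetP => [/subsetP Au|].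
    exists (u * s^-1)%g; last by rewrite mulgKV.
    rewrite inE; apply/subsetP => i; rewrite inE permM; apply: contraR.
    rewrite inE negbK => /imsetP[[k l] kl /= ->].
    by have := Au _ kl; have := As' _ kl; rewrite !inE /= => /eqP <- /eqP ->; rewrite permK.
  case=> v; rewrite inE => vA ->; apply/subsetP => -[i j] ij.
  rewrite inE /= permM (out_perm vA) ?inE ?negbK; last by apply/imsetP; exists (i, j).
  by have := As' _ ij; rewrite inE.
rewrite card_imset; last exact: mulIg.
by rewrite cardsE card_perm cardsCs setCK (card_dom As) card_ord.
Qed.

Lemma card_fam_le F A : (#|fam F A| <= (n - #|A|)`!)%N.
Proof.
have [->|[s]] := set_0Vmem (fam F A); first by rewrite cards0.
by move=> /mem_fam[_ As]; rewrite -(card_famT As) subset_leq_card ?famS ?subsetT.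
Qed.

Lemma card_row_sum F i : (\sum_j #|fam F [set (i, j)]| = #|F|)%N.
Proof.
under eq_bigr => j _ do rewrite -sum1_card.
rewrite -[RHS]sum1_card.
rewrite (partition_big (fun s : {perm 'I_n} => s i) xpredT) //=.
apply: eq_bigr => j _; apply: eq_bigl => s.
by rewrite inE sub1set mem_gr.
Qed.

(* Markov's inequality *)
Lemma card_hits F D h :
  (h * #|[set s in F | (h <= #|gr s :&: D|)%N]| <= \sum_(y in D) #|fam F [set y]|)%N.
Proof.
have -> : (\sum_(y in D) #|fam F [set y]| = \sum_(s in F) #|gr s :&: D|)%N.
  under eq_bigr => y _ do rewrite -sum1_card.
  under [RHS]eq_bigr => s _ do rewrite -sum1_card.
  rewrite (exchange_big_dep (mem F)) /=; last by move=> y s _ /mem_fam[].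
  apply: eq_bigr => s sF; apply: eq_bigl => y.
  by rewrite !inE sF sub1set inE andbC.
rewrite mulnC -sum_nat_const.
rewrite [leqRHS](bigID (fun s => h <= #|gr s :&: D|)%N) /=.
apply: leq_trans (leq_addr _ _).
under eq_bigl => s do rewrite inE.
by apply: leq_sum => s /andP[].
Qed.

(** A union bound; it turns large intersections with [B] into densities above [m]-subsets of [B]. *)
Lemma card_cover F B m : (forall s, s \in F -> (m <= #|gr s :&: B|)%N) ->
  (#|F| <= \sum_(T : {set 'I_n * 'I_n} | (T \subset B) && (#|T| == m)) #|fam F T|)%N.
Proof.
move=> FB.
under eq_bigr => T _ do rewrite -sum1_card.
rewrite (exchange_big_dep (mem F)) /=; last by move=> y s _ /mem_fam[].
rewrite -[leqLHS]sum1_card; apply: leq_sum => s sF.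
have : (0 < 'C(#|gr s :&: B|, m))%N by rewrite bin_gt0 FB.
rewrite -cards_draws -sum1_card => /leq_trans; apply.
apply: eq_leq; apply: eq_bigl => T.
by rewrite !inE sF subsetI; case: (T \subset gr s); case: (T \subset B); case: (#|T| == m).
Qed.

End Families.

(** * Densities and maximal restrictions *)

Section Densities.
Context (R : realFieldType) (n : nat).
Implicit Types (s u : {perm 'I_n}) (F G : {set {perm 'I_n}}).
Implicit Types (A B D : {set 'I_n * 'I_n}) (r : R).

(* The normalisation is by the number of permutations through a partial
   permutation of size [#|A|]; if [A] is not a partial permutation, [dens A F = 0]. *)
Definition dens A F : R := #|fam F A|%:R / (n - #|A|)`!%:R.

Definition pot r A F : R := dens A F / r ^+ #|A|.

Definition few_hits F D h : {set {perm 'I_n}} :=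
  [set s in F | (#|gr s :&: D| <= h)%N].

(* [F] lives above [A] and no further point multiplies its density by more than
   [r]; such pairs come from maximising [pot r], as [max_glob] shows. *)
Definition glob r A F : Prop :=
  (forall s, s \in F -> A \subset gr s) /\
  (forall D, A \subset D -> pot r D F <= pot r A F).

(** The base [A0] protects points already imposed when a family is made global again. *)
Definition is_max r A0 F A : Prop :=
  A0 \subset A /\ forall D, A0 \subset D -> pot r D F <= pot r A F.

Lemma fact_gt0R (m : nat) : 0 < m`!%:R :> R.
Proof. by rewrite ltr0n fact_gt0. Qed.

Lemma dens_ge0 A F : 0 <= dens A F.
Proof. by rewrite divr_ge0 ?ler0n. Qed.

Lemma dens_le1 A F : dens A F <= 1.
Proof. by rewrite ler_pdivrMr ?fact_gt0R // mul1r ler_nat card_fam_le. Qed.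

Lemma pot_ge0 r A F : 0 <= r -> 0 <= pot r A F.
Proof. by move=> r0; rewrite divr_ge0 ?dens_ge0 ?exprn_ge0. Qed.

Lemma densE A F : (forall s, s \in F -> A \subset gr s) ->
  dens A F = #|F|%:R / (n - #|A|)`!%:R.
Proof. by move=> FA; rewrite /dens fam_id. Qed.

Lemma dens_set0 F : dens set0 F = #|F|%:R / n`!%:R.
Proof. by rewrite /dens fam0 cards0 subn0. Qed.

Lemma dens_gt0 A F : 0 < dens A F -> exists2 s, s \in F & A \subset gr s.
Proof.
rewrite /dens; have [->|[s /mem_fam[sF As]] _] := set_0Vmem (fam F A); last by exists s.
by rewrite cards0 mul0r ltxx.
Qed.

Lemma pot_gt0 r A F : 0 < r -> 0 < pot r A F -> exists2 s, s \in F & A \subset gr s.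
Proof.
by move=> r0; rewrite pmulr_lgt0 ?invr_gt0 ?exprn_gt0 //; apply: dens_gt0.
Qed.

Lemma exists_max r A0 F : exists A, is_max r A0 F A.
Proof.
pose A := [arg max_(D > A0 | A0 \subset D) pot r D F]%O.
exists A; rewrite /A; case: Order.TotalTheory.arg_maxP => [|A1 A01 Am]; first exact: subxx.
by split=> // D /Am.
Qed.

Lemma pot_famE r A D F : A \subset D -> pot r D (fam F A) = pot r D F.
Proof. by move=> AD; rewrite /pot /dens famU (setUidPr AD). Qed.

Lemma max_glob r A0 A F : is_max r A0 F A -> glob r A (fam F A).
Proof.
case=> A0A Am; split=> [s /mem_fam[]//|D AD].
by rewrite !pot_famE // Am // (subset_trans A0A).
Qed.

(** Densities are at most 1, so a potential of at least [r ^- M] leaves room for at most [M] points.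
    This lets potentials, rather than sizes, be carried through the inductions. *)
Lemma pot_size r A F M : 1 < r -> r ^- M <= pot r A F -> (#|A| <= M)%N.
Proof.
move=> r1 pM; have r0 : 0 < r by apply: lt_trans r1.
have : r ^- M <= r ^- #|A|.
  apply: le_trans pM _; rewrite /pot ler_pdivrMr ?exprn_gt0 //.
  by rewrite mulVf ?dens_le1 // expf_neq0 // gt_eqF.
by rewrite lef_pV2 ?posrE ?exprn_gt0 // ler_eXn2l.
Qed.

Lemma glob_card r A D F : 0 < r -> glob r A F -> A \subset D ->
  #|fam F D|%:R * (n - #|A|)`!%:R <= r ^+ (#|D| - #|A|) * (n - #|D|)`!%:R * #|F|%:R.
Proof.
move=> r0 [FA Fm] AD; have := Fm _ AD; rewrite /pot (densE FA) /dens.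
rewrite -!mulrA -!invfM ler_pdivrMr ?mulr_gt0 ?fact_gt0R ?exprn_gt0 //.
rewrite mulrAC ler_pdivlMr ?mulr_gt0 ?fact_gt0R ?exprn_gt0 //.
rewrite -[in r ^+ #|D|](subnK (subset_leq_card AD)) exprD.
move=> H; have rA := exprn_gt0 #|A| r0.
rewrite -(ler_pM2r rA); nra.
Qed.

Lemma glob_single r A F y : 0 < r -> glob r A F -> y \notin A ->
  #|fam F [set y]|%:R * (n - #|A|)%:R <= r * #|F|%:R.
Proof.
move=> r0 gF yA; have [FA _] := gF.
have fE : fam F [set y] = fam F (y |: A).
  by rewrite setUC -famU (fam_id FA).
have := glob_card r0 gF (subsetUr [set y] A).
rewrite fE cardsU1 yA /= add1n subSnn expr1.
have [->|[s /mem_fam[sF /card_sub_gr]]] := set_0Vmem (fam F (y |: A)).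
  by move=> _; rewrite cards0 mul0r mulr_ge0 // ltW.
rewrite cardsU1 yA add1n => An; rewrite -(subnSK An) factS natrM.
have f0 := fact_gt0R (n - #|A|.+1)%N.
by move=> H; rewrite -(ler_pM2r f0); lra.
Qed.

(** Needed after a first point has been fixed: the restricted family need not be global any more,
    but pairs above [A] still bound its single-point densities. *)
Lemma glob_pair r A F y z : 0 < r -> glob r A F -> y \notin A -> z \notin y |: A ->
  #|fam F [set y; z]|%:R * ((n - #|A|)%:R * (n - #|A|.+1)%:R) <= r ^+ 2 * #|F|%:R.
Proof.
move=> r0 gF yA zA; have [FA _] := gF.
have fE : fam F [set y; z] = fam F (z |: (y |: A)).
  have -> : z |: (y |: A) = A :|: [set y; z].
    by rewrite setUA setUC [[set z] :|: _]setUC.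
  by rewrite -(famU _ A) (fam_id FA).
have := glob_card r0 gF (subset_trans (subsetUr [set y] A) (subsetUr [set z] _)).
rewrite fE !cardsU1 zA yA /= !add1n -[#|A|.+2]addn2 addnC addnK.
have [->|[s /mem_fam[sF /card_sub_gr]]] := set_0Vmem (fam F (z |: (y |: A))).
  by move=> _; rewrite cards0 mul0r mulr_ge0 // exprn_ge0 // ltW.
rewrite !cardsU1 yA zA !add1n add2n => An.
rewrite -(subnSK (ltnW An)) factS natrM -(subnSK An) factS natrM.
have f0 := fact_gt0R (n - #|A|.+2)%N.
by move=> H; rewrite -(ler_pM2r f0); lra.
Qed.

Lemma few_hits_sub F D h : few_hits F D h \subset F.
Proof. by apply/subsetP => s; rewrite inE => /andP[]. Qed.

(** The average number of hits in [D] is at most [p * #|D|]; Markov's inequality bounds the share of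
    members with more than [h]. *)
Lemma few_hits_card F D h (p : R) :
  (forall y, y \in D -> #|fam F [set y]|%:R <= p * #|F|%:R) ->
  (1 - p * #|D|%:R / h.+1%:R) * #|F|%:R <= #|few_hits F D h|%:R.
Proof.
move=> pD; have h0 : 0 < h.+1%:R :> R by rewrite ltr0n.
set Bad := [set s in F | (h.+1 <= #|gr s :&: D|)%N].
have FE : #|F| = (#|few_hits F D h| + #|Bad|)%N.
  rewrite -(cardsID (few_hits F D h) F) (setIidPr (few_hits_sub _ _ _)); congr addn.
  by apply: eq_card => s; rewrite !inE ltnNge; case: (s \in F) => //=; rewrite andbT.
have : h.+1%:R * #|Bad|%:R <= p * #|F|%:R * #|D|%:R.
  rewrite -natrM; apply: (@le_trans _ _ (\sum_(y in D) #|fam F [set y]|)%N%:R).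
    by rewrite ler_nat card_hits.
  by rewrite natr_sum mulr_natr -sumr_const; apply: ler_sum.
rewrite mulrC -ler_pdivlMr //.
move: FE => /(congr1 (fun m => m%:R : R)) /=; rewrite natrD => FE.
have -> : (1 - p * #|D|%:R / h.+1%:R) * #|F|%:R = #|F|%:R - p * #|F|%:R * #|D|%:R / h.+1%:R.
  by ring.
by rewrite FE lerBlDr lerD2l.
Qed.

(** The order matters: [A1] is chosen for [F] before [G] is thinned against [A1 :\: B], while [F]
    already rarely hits [B :\: A]. A common point of [A1] and [B1] then lies in [A :&: B], or is a
    hit of some member of [F] in [B :\: A], or a hit of some member of the thinned [G] in
    [A1 :\: B]. Only [G] loses, by a factor 2. *)
Lemma regularize r F G A B h1 h2 : 0 < r ->
  (forall s, s \in F -> A \subset gr s) -> (forall u, u \in G -> B \subset gr u) ->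
  (forall s, s \in F -> (#|gr s :&: (B :\: A)| <= h1)%N) ->
  0 < pot r A F -> 0 < pot r B G ->
  (forall D, A \subset D -> pot r A F <= pot r D F ->
     #|G|%:R <= 2%:R * #|few_hits G (D :\: B) h2|%:R :> R) ->
  exists A1 B1 F1 G1,
    [/\ [/\ A \subset A1, B \subset B1, F1 \subset F & G1 \subset G],
        glob r A1 F1 /\ glob r B1 G1,
        pot r A F <= pot r A1 F1 /\ pot r B G <= 2%:R * pot r B1 G1 &
        (#|A1 :&: B1| <= #|A :&: B| + h1 + h2)%N].
Proof.
move=> r0 FA GB FB pA pB GD.
have [A1 mA1] := exists_max r A F; have [AA1 A1m] := mA1.
have pA1 : pot r A F <= pot r A1 F by apply: A1m.
pose G0 := few_hits G (A1 :\: B) h2.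
have G0G : G0 \subset G by apply: few_hits_sub.
have G0B u : u \in G0 -> B \subset gr u by move=> /(subsetP G0G)/GB.
have [B1 mB1] := exists_max r B G0; have [BB1 B1m] := mB1.
have pB1 : pot r B G <= 2%:R * pot r B1 G0.
  apply: (@le_trans _ _ (2%:R * pot r B G0)); last by rewrite ler_pM2l ?B1m.
  rewrite /pot (densE GB) (densE G0B) !mulrA ler_pM2r ?invr_gt0 ?exprn_gt0 //.
  by rewrite ler_pM2r ?invr_gt0 ?fact_gt0R //; apply: GD.
exists A1, B1, (fam F A1), (fam G0 B1); split.
- by rewrite AA1 BB1 fam_sub (subset_trans (fam_sub _ _)).
- by split; apply: max_glob; [exact: mA1|exact: mB1].
- by rewrite !pot_famE.
- have [s sF A1s] := pot_gt0 r0 (lt_le_trans pA pA1).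
have [u uG B1u] : exists2 u, u \in G0 & B1 \subset gr u.
  by apply: (pot_gt0 r0); have := lt_le_trans pB pB1; rewrite pmulr_rgt0.
have sub : A1 :&: B1 \subset (A :&: B) :|: (gr s :&: (B :\: A)) :|: (gr u :&: (A1 :\: B)).
  apply/subsetP => y /setIP[yA1 yB1].
  rewrite !in_setU !in_setI !in_setD yA1 (subsetP A1s _ yA1) (subsetP B1u _ yB1) /=.
  by case: (y \in A); case: (y \in B).
apply: leq_trans (subset_leq_card sub) _.
apply: leq_trans (leq_card_setU _ _) _; apply: leq_add; last first.
  by move: uG; rewrite inE => /andP[].
apply: leq_trans (leq_card_setU _ _) _; apply: leq_add => //.
exact: FB.
Qed.

End Densities.

(** * Disjoint pairs in two global families *)

Section Disjointness.
Context (R : realFieldType) (n : nat).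
Implicit Types (s u : {perm 'I_n}) (f g h : {perm 'I_n} -> R) (S : {set 'I_n}).

(** As a matrix this is [n] times the orthogonal projection onto vectors of sum zero, hence positive
    semidefinite. *)
Definition zker (x y : 'I_n) : R := n%:R * (x == y)%:R - 1.

Definition corr S f g : R :=
  \sum_s \sum_u f s * g u * \prod_(i in S) zker (s i) (u i).

Lemma zker_sym x y : zker x y = zker y x.
Proof. by rewrite /zker eq_sym. Qed.

Lemma zker_gram x y : zker x y =
  \sum_z n%:R * (((x == z)%:R - n%:R^-1) * ((y == z)%:R - n%:R^-1)).
Proof.
have n0 : n%:R != 0 :> R by rewrite pnatr_eq0 -lt0n (leq_ltn_trans _ (ltn_ord x)).
rewrite -mulr_sumr.
under eq_bigr => z _ do rewrite mulrBl !mulrBr opprB.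
rewrite !big_split /= !sumrN -!mulr_sumr -!mulr_suml sumr_const card_ord.
have sumd w : \sum_(z < n) (w == z)%:R = 1 :> R.
  by rewrite (bigD1 w) //= eqxx big1 ?addr0 // => z; rewrite eq_sym => /negbTE ->.
have -> : \sum_(z < n) (x == z)%:R * (y == z)%:R = (x == y)%:R :> R.
  rewrite (bigD1 x) //= eqxx mul1r big1 ?addr0 1?eq_sym // => z.
  by rewrite eq_sym => /negbTE ->; rewrite mul0r.
rewrite !sumd /zker -mulr_natr.
by field.
Qed.

(** A product of Gram kernels is a Gram kernel, with vectors indexed by functions from [S] to
    columns; the form becomes a sum of squares. *)
Lemma corr_ge0 S h : 0 <= corr S h h.
Proof.
(* Indexing by functions supported on [S] needs a default column; without one [n = 0] and there is a
   single permutation. *)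
have [x0 _|n0] := pickP (predT : pred 'I_n); last first.
  rewrite /corr; apply: sumr_ge0 => s _; apply: sumr_ge0 => u _.
  have -> : u = s by apply/permP => i; have := n0 i.
  by rewrite big1 ?mulr1 -?expr2 ?sqr_ge0 // => i; have := n0 i.
pose e (x z : 'I_n) : R := (x == z)%:R - n%:R^-1.
pose W s (w : {ffun 'I_n -> 'I_n}) := \prod_(i in S) e (s i) (w i).
have prodE s u : \prod_(i in S) zker (s i) (u i) =
    \sum_(w in pffun_on x0 (mem S) predT) n%:R ^+ #|S| * (W s w * W u w).
  under eq_bigr => i _ do rewrite zker_gram.
  rewrite (big_distr_big x0) /=; apply: eq_bigr => w _.
  by rewrite big_split /= prodr_const big_split.
rewrite /corr.
under eq_bigr => s _ do under eq_bigr => u _ do rewrite prodE mulr_sumr.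
under eq_bigr => s _ do rewrite exchange_big.
rewrite exchange_big; apply: sumr_ge0 => w _.
have -> : \sum_s \sum_u h s * h u * (n%:R ^+ #|S| * (W s w * W u w)) =
    n%:R ^+ #|S| * (\sum_s h s * W s w) ^+ 2.
  rewrite expr2 mulr_suml mulr_sumr; apply: eq_bigr => s _.
  by rewrite mulr_sumr mulr_sumr; apply: eq_bigr => u _; ring.
by rewrite mulr_ge0 ?sqr_ge0 ?exprn_ge0 ?ler0n.
Qed.

Lemma corr_sym S f g : corr S f g = corr S g f.
Proof.
rewrite /corr exchange_big; apply: eq_bigr => s _; apply: eq_bigr => u _.
by rewrite [g s * _]mulrC; congr (_ * _); apply: eq_bigr => i _; rewrite zker_sym.
Qed.

(** Positivity of the form at [f + g] or [f - g], according to the sign. *)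
Lemma corr_cross S f g (b : bool) :
  0 <= (-1) ^+ b * corr S f g + (corr S f f + corr S g g) / 2.
Proof.
have := corr_ge0 S (fun s => f s + (-1) ^+ b * g s).
have -> : corr S (fun s => f s + (-1) ^+ b * g s) (fun s => f s + (-1) ^+ b * g s) =
    corr S f f + corr S g g + (-1) ^+ b * (corr S f g + corr S g f).
  rewrite /corr -!big_split /= mulr_sumr -big_split; apply: eq_bigr => s _ /=.
  rewrite -!big_split /= mulr_sumr -big_split; apply: eq_bigr => u _ /=.
  by case: b; rewrite ?expr1 ?expr0; ring.
by rewrite [corr S g f]corr_sym => H; lra.
Qed.

Lemma prod_zker_expand (c : R) (rho : 'I_n -> R) f g :
  \sum_s \sum_u f s * g u * \prod_i (1 + c * rho i * zker (s i) (u i)) =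
  \sum_(S : {set 'I_n}) c ^+ #|S| * (\prod_(i in S) rho i) * corr S f g.
Proof.
transitivity (\sum_s \sum_u \sum_(S : {set 'I_n})
   f s * g u * (c ^+ #|S| * (\prod_(i in S) rho i) * \prod_(i in S) zker (s i) (u i))).
  apply: eq_bigr => s _; apply: eq_bigr => u _; rewrite -mulr_sumr; congr (_ * _).
  under eq_bigr => i _ do rewrite addrC.
  rewrite bigA_distr; apply: eq_bigr => S _.
  by rewrite -big_mkcond /= !big_split /= prodr_const.
under eq_bigr => s _ do rewrite exchange_big.
rewrite exchange_big; apply: eq_bigr => S _.
rewrite /corr mulr_sumr; apply: eq_bigr => s _; rewrite mulr_sumr.
by apply: eq_bigr => u _; ring.
Qed.

(* The kernels [1 - rho * zker] and [1 + rho * zker] differ only by signs of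
   positive semidefinite terms, so the off-diagonal form is controlled by the
   two diagonal ones. *)
Lemma cross_sum_ge (rho : 'I_n -> R) f g :
  (forall i, 0 <= rho i) -> \sum_s f s = 1 -> \sum_s g s = 1 ->
  2 <= \sum_s \sum_u f s * g u * \prod_i (1 - rho i * zker (s i) (u i)) +
    (\sum_s \sum_u f s * f u * \prod_i (1 + rho i * zker (s i) (u i)) +
     \sum_s \sum_u g s * g u * \prod_i (1 + rho i * zker (s i) (u i))) / 2.
Proof.
move=> rho0 f1 g1.
have plusE h : \sum_s \sum_u h s * h u * \prod_i (1 + rho i * zker (s i) (u i)) =
    \sum_(S : {set 'I_n}) (\prod_(i in S) rho i) * corr S h h.
  transitivity (\sum_s \sum_u h s * h u * \prod_i (1 + 1 * rho i * zker (s i) (u i))).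
    apply: eq_bigr => s _; apply: eq_bigr => u _.
    by congr (_ * _); apply: eq_bigr => i _; rewrite mul1r.
  by rewrite prod_zker_expand; apply: eq_bigr => S _; rewrite expr1n mul1r.
have minusE : \sum_s \sum_u f s * g u * \prod_i (1 - rho i * zker (s i) (u i)) =
    \sum_(S : {set 'I_n}) (-1) ^+ #|S| * (\prod_(i in S) rho i) * corr S f g.
  rewrite -prod_zker_expand; apply: eq_bigr => s _; apply: eq_bigr => u _.
  by congr (_ * _); apply: eq_bigr => i _; rewrite -mulrA mulN1r.
rewrite !plusE minusE -big_split mulr_suml -big_split /=.
have corr0 h h' : \sum_s h s = 1 -> \sum_s h' s = 1 -> corr set0 h h' = 1.
  move=> h1 h1'; transitivity ((\sum_s h s) * (\sum_s h' s)); last by rewrite h1 h1' mulr1.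
  rewrite /corr mulr_suml.
  apply: eq_bigr => s _; rewrite mulr_sumr; apply: eq_bigr => u _.
  by rewrite big_set0 mulr1.
(* The empty set contributes 1 + (1 + 1) / 2 = 2, and every other set a nonnegative amount. *)
rewrite (bigD1 set0) //= cards0 big_set0 !corr0 // expr0 -[leLHS]addr0.
apply: lerD; first by lra.
apply: sumr_ge0 => S _.
have p0 : 0 <= \prod_(i in S) rho i by apply: prodr_ge0.
have := corr_cross S f g (odd #|S|); rewrite signr_odd => H.
have -> : (-1) ^+ #|S| * (\prod_(i in S) rho i) * corr S f g +
   ((\prod_(i in S) rho i) * corr S f f + (\prod_(i in S) rho i) * corr S g g) / 2 =
   (\prod_(i in S) rho i) * ((-1) ^+ #|S| * corr S f g + (corr S f f + corr S g g) / 2).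
  by ring.
exact: mulr_ge0.
Qed.

End Disjointness.

(** * Exponential moments of the number of agreements *)

Section DiagonalForm.
Context (R : realType) (n : nat).
Implicit Types (s u : {perm 'I_n}) (F G : {set {perm 'I_n}}).
Implicit Types (A B D : {set 'I_n * 'I_n}) (r : R) (I S : {set 'I_n}).

Lemma exp_partial_sum_le (x : R) m : 0 <= x -> \sum_(k < m) x ^+ k / k`!%:R <= expR x.
Proof.
move=> x0; rewrite -(big_mkord xpredT (fun k => x ^+ k / k`!%:R)).
apply: (@nondecreasing_cvgn_le R (series (exp_coeff x)) _ _ m).
  by apply: nondecreasing_series => k _ _; rewrite /exp_coeff divr_ge0 ?exprn_ge0 ?ler0n.
exact: is_cvg_series_exp_coeff.
Qed.

Lemma sum_subsets_card (I : {set 'I_n}) (c : nat -> R) :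
  \sum_(S : {set 'I_n} | S \subset I) c #|S| = \sum_(k < #|I|.+1) 'C(#|I|, k)%:R * c k.
Proof.
rewrite (partition_big (fun S : {set 'I_n} => inord #|S| : 'I_(#|I|.+1)) xpredT) //=.
apply: eq_bigr => k _; rewrite -cards_draws -sumr_const mulr_suml.
rewrite [RHS]big_mkcond [LHS]big_mkcond; apply: eq_bigr => S _.
rewrite mul1r !inE; case: (boolP (S \subset I)) => //= SI.
rewrite -val_eqE /= inordK ?ltnS ?subset_leq_card //.
by case: eqP => // ->.
Qed.

Definition restr s S : {set 'I_n * 'I_n} := [set (i, s i) | i in S].

Lemma card_restr s S : #|restr s S| = #|S|.
Proof. by rewrite card_imset // => i j []. Qed.

Lemma restr_sub s u S : (restr s S \subset gr u) = [forall (i | i \in S), s i == u i].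
Proof.
apply/subsetP/forall_inP => [H i iS|H].
  by have := H (i, s i) (imset_f _ iS); rewrite inE eq_sym.
by move=> _ /imsetP[i iS ->]; rewrite inE eq_sym H.
Qed.

Lemma prod_agree (w : R) I s u :
  \prod_(i in I) (1 + w * (s i == u i)%:R) =
  \sum_(S : {set 'I_n} | S \subset I) w ^+ #|S| * (restr s S \subset gr u)%:R.
Proof.
rewrite [LHS]big_mkcond /=.
transitivity (\prod_i ((if i \in I then w * (s i == u i)%:R else 0) + 1)).
  by apply: eq_bigr => i _; case: (i \in I); rewrite ?add0r // addrC.
rewrite bigA_distr [RHS]big_mkcond; apply: eq_bigr => S _.
rewrite -big_mkcond /=; case: (boolP (S \subset I)) => [SI|/subsetPn[i iS iI]]; last first.
  by rewrite (bigD1 i) //= (negbTE iI) mul0r.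
rewrite restr_sub; under eq_bigr => i iS do rewrite (subsetP SI _ iS).
rewrite big_split prodr_const; congr (_ * _).
case: forall_inP => [H|]; first by rewrite big1 // => i /H ->.
case: (boolP [exists (i | i \in S), s i != u i]) => [/exists_inP[i iS /negbTE su] _|].
  by rewrite (bigD1 i) //= su mul0r.
by rewrite negb_exists_in => /forall_inP H []; move=> i /H; rewrite negbK.
Qed.

(** As [rho * n = 1 + rho], each factor is [1 - rho] times [1 + w * [agreement]] with
    [w = (1 + rho) / (1 - rho)]. Expanding over sets [S] of agreeing rows, globality bounds each
    share by [r ^+ #|S|] times the uniform one, and the binomials turn the sum into a partial
    exponential series in [r * w]. The factor [kap] pays for replacing the global [F0] by its
    subfamily [F]. *)
Lemma diag_sum_le r (rho kap : R) F F0 A I :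
  0 < r -> 0 <= rho -> rho < 1 -> glob r A F0 -> F \subset F0 ->
  #|F0|%:R <= kap * #|F|%:R :> R -> [disjoint I & fst @: A] ->
  (#|I| <= n - #|A|)%N -> rho * n%:R = 1 + rho ->
  \sum_(s in F) \sum_(u in F) \prod_(i in I) (1 + rho * zker R (s i) (u i)) <=
  (1 - rho) ^+ #|I| * (kap * #|F|%:R ^+ 2) * expR (r * ((1 + rho) / (1 - rho))).
Proof.
move=> r0 rho0 rho1 gF FF0 kapF IA Im rhon.
set w := (1 + rho) / (1 - rho).
have r1 : 0 < 1 - rho by rewrite subr_gt0.
have w0 : 0 <= w by apply: divr_ge0; [apply: addr_ge0|apply: ltW].
set m := (n - #|A|)%N in Im *.
have zE (x y : 'I_n) : 1 + rho * zker R x y = (1 - rho) * (1 + w * (x == y)%:R).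
  have -> : rho * zker R x y = (1 + rho) * (x == y)%:R - rho.
    by rewrite -rhon /zker mulrBr mulr1 mulrA.
  have wE : (1 - rho) * w = 1 + rho by rewrite /w mulrC divfK ?gt_eqF.
  rewrite mulrDr mulr1 [(1 - rho) * _]mulrA wE.
  by rewrite [_ * _ - rho]addrC addrA.
have step s u : \prod_(i in I) (1 + rho * zker R (s i) (u i)) =
    (1 - rho) ^+ #|I| * \sum_(S : {set 'I_n} | S \subset I) w ^+ #|S| * (restr s S \subset gr u)%:R.
  by rewrite -prod_agree -prodr_const -big_split; apply: eq_bigr => i _; apply: zE.
under eq_bigr => s _ do under eq_bigr => u _ do rewrite step.
under eq_bigr => s _ do rewrite -mulr_sumr.
rewrite -mulr_sumr -!mulrA ler_pM2l ?exprn_gt0 //.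
have inner s S : s \in F -> S \subset I ->
    \sum_(u in F) (restr s S \subset gr u)%:R <=
    r ^+ #|S| * (m - #|S|)`!%:R / m`!%:R * (kap * #|F|%:R).
  move=> sF SI; have [F0A _] := gF.
  have As := F0A _ (subsetP FF0 _ sF).
  have dAS : [disjoint A & restr s S].
    rewrite -setI_eq0; apply/eqP/setP => -[i j]; rewrite !inE; apply/negbTE.
    apply/negP => /andP[ijA /imsetP[k kS [ik _]]].
    have := disjointFr IA (subsetP SI _ kS); rewrite -ik.
    by move/imsetP; apply; exists (i, j).
  have cU : #|A :|: restr s S| = (#|A| + #|S|)%N.
    by rewrite cardsU (disjoint_setI0 dAS) cards0 subn0 card_restr.
  have := glob_card r0 gF (subsetUl A (restr s S)).
  rewrite cU addKn -/m subnDA -/m -ler_pdivlMr ?fact_gt0R // => H.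
  apply: le_trans (_ : #|fam F0 (A :|: restr s S)|%:R <= _).
    rewrite -natr_sum ler_nat -big_mkcondr sum1_card subset_leq_card //.
    apply/subsetP => u; rewrite !inE => /andP[uF us].
    by rewrite (subsetP FF0 _ uF) subUset us (F0A _ (subsetP FF0 _ uF)).
  apply: le_trans H _; rewrite [leRHS]mulrAC ler_pM2r ?invr_gt0 ?fact_gt0R //.
  by rewrite ler_pM2l ?mulr_gt0 ?fact_gt0R ?exprn_gt0.
have kapF0 : 0 <= kap * #|F|%:R by apply: le_trans kapF.
have row s : s \in F -> \sum_(u in F) \sum_(S : {set 'I_n} | S \subset I)
    w ^+ #|S| * (restr s S \subset gr u)%:R <= expR (r * w) * (kap * #|F|%:R).
  move=> sF; rewrite exchange_big /=.
  pose c k : R := w ^+ k * (r ^+ k * (m - k)`!%:R / m`!%:R * (kap * #|F|%:R)).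
  apply: (@le_trans _ _ (\sum_(S : {set 'I_n} | S \subset I) c #|S|)).
    by apply: ler_sum => S SI; rewrite -mulr_sumr ler_wpM2l ?exprn_ge0 ?inner.
  rewrite sum_subsets_card.
  apply: (@le_trans _ _ (\sum_(k < #|I|.+1) (r * w) ^+ k / k`!%:R * (kap * #|F|%:R))).
    apply: ler_sum => k _; rewrite /c mulrA mulrA ler_wpM2r //.
    have km : (k <= m)%N by rewrite (leq_trans _ Im) // -ltnS.
    have -> : 'C(#|I|, k)%:R * w ^+ k * (r ^+ k * (m - k)`!%:R / m`!%:R) =
        (r * w) ^+ k * ('C(#|I|, k)%:R * (m - k)`!%:R / m`!%:R).
      rewrite [(r * w) ^+ k]exprMn; move: ('C(#|I|, k)%:R : R) ((m - k)`!%:R : R) (m`!%:R^-1 : R) (w ^+ k) (r ^+ k).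
      by move=> a b d e f; ring.
    apply: ler_wpM2l; first by rewrite exprn_ge0 // mulr_ge0 // ltW.
    rewrite ler_pdivrMr ?fact_gt0R // ler_pdivlMl ?fact_gt0R // -!natrM ler_nat.
    by rewrite -(bin_fact km) mulnCA leq_mul2r leq_bin2l ?orbT.
  rewrite -mulr_suml ler_wpM2r //; apply: exp_partial_sum_le.
  by rewrite mulr_ge0 ?(ltW r0).
apply: le_trans (ler_sum _ row) _.
have sumc (c : R) : \sum_(s in F) c = c * #|F|%:R by rewrite sumr_const mulr_natr.
rewrite sumc le_eqVlt; apply/orP; left; apply/eqP.
by move: (#|F|%:R : R) (expR _) => a b; ring.
Qed.
End DiagonalForm.

(** * Pairs of permutations that disagree on a set of rows *)

Section DisjointPair.
Context (R : realType) (n : nat).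
Implicit Types (s u : {perm 'I_n}) (F G : {set {perm 'I_n}}).
Implicit Types (A B D : {set 'I_n * 'I_n}) (I : {set 'I_n}).

(** The power of [1 - rho] is close to exp (-1), so the normalised form is about exp (r - 1), which
    leaves room below 2. *)
Lemma diag_lt2 F F0 A I : (1000 <= n)%N ->
  glob (5 / 4 : R) A F0 -> F \subset F0 -> (99 * #|F0| <= 100 * #|F|)%N -> (0 < #|F|)%N ->
  [disjoint I & fst @: A] -> (#|I| <= n - #|A|)%N -> (499 * n <= 500 * #|I|)%N ->
  \sum_(s in F) \sum_(u in F) \prod_(i in I) (1 + n.-1%:R^-1 * zker R (s i) (u i)) <
  2 * #|F|%:R ^+ 2.
Proof.
move=> n1000 gF FF0 FF0c Fgt0 IA IAn In.
have n1 : n.-1%:R = n%:R - 1 :> R by rewrite -subn1 natrB // (leq_trans _ n1000).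
have nR : 1000 <= n%:R :> R by rewrite ler_nat.
set rho : R := n.-1%:R^-1.
have rhoE : rho * (n%:R - 1) = 1 by rewrite -n1 mulVf // n1 gt_eqF //; lra.
have rho0 : 0 < rho by rewrite invr_gt0 n1; lra.
have rho1 : rho <= 1 / 999 by rewrite /rho n1 mul1r lef_pV2 ?posrE; lra.
have rhon : rho * n%:R = 1 + rho by lra.
have kap : #|F0|%:R <= 100 / 99 * #|F|%:R :> R.
  by move: FF0c; rewrite -(ler_nat R) !natrM => H; lra.
have FR : 0 < #|F|%:R :> R by rewrite ltr0n Fgt0.
apply: le_lt_trans (diag_sum_le _ _ _ gF FF0 kap IA IAn rhon) _; [lra|lra|lra|].
have e1 : (1 - rho) ^+ #|I| <= expR (- (rho * #|I|%:R)).
  rewrite -mulNr expRM_natr; apply: lerXn2r; rewrite ?nnegrE ?expR_ge0 //; first by lra.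
  exact: expR_ge1Dx.
have rI : 998 / 1000 <= rho * #|I|%:R.
  have : 499 * n%:R <= 500 * #|I|%:R :> R by rewrite -!natrM ler_nat.
  move=> /(ler_wpM2l (ltW rho0)).
  have -> : rho * (499 * n%:R) = 499 * (1 + rho) by rewrite -rhon; ring.
  have -> : rho * (500 * #|I|%:R) = 500 * (rho * #|I|%:R) by ring.
  by lra.
have rw : (1 + rho) / (1 - rho) <= 1003 / 1000.
  by rewrite ler_pdivrMr; lra.
(* The exponent is at most 5/4 * 1.003 - 0.998 < 3/10, and exp (-3/10) >= 7/10. *)
have e2 : expR (- (rho * #|I|%:R)) * expR (5 / 4 * ((1 + rho) / (1 - rho))) <= 10 / 7.
  rewrite -expRD; apply: (@le_trans _ _ (expR (3 / 10))).
    by rewrite ler_expR; lra.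
  have := expR_ge1Dx (- (3 / 10) : R); rewrite expRN => H.
  have e0 := expR_gt0 (3 / 10 : R).
  rewrite -[leLHS]invrK -[10 / 7]invrK lef_pV2 ?posrE ?invr_gt0 //; last by lra.
  by apply: le_trans H; rewrite invf_div; lra.
apply: (@le_lt_trans _ _ (10 / 7 * (100 / 99 * #|F|%:R ^+ 2))); last first.
  by have := exprn_gt0 2 FR; lra.
rewrite mulrAC ler_wpM2r //; first by rewrite mulr_ge0 ?exprn_ge0 ?ltW //; lra.
by apply: le_trans e2; rewrite ler_wpM2r ?expR_ge0.
Qed.

(** The value [rho = 1 / (n - 1)] makes [1 - rho * zker] vanish exactly on agreements. If every pair
    agreed in some row of [I], the off-diagonal sum would be 0, and two normalised diagonal forms
    below 2 would contradict [cross_sum_ge]. *)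
Lemma disagree_exists F G F0 G0 A B I : (1000 <= n)%N ->
  glob (5 / 4 : R) A F0 -> F \subset F0 -> (99 * #|F0| <= 100 * #|F|)%N -> (0 < #|F|)%N ->
  glob (5 / 4 : R) B G0 -> G \subset G0 -> (99 * #|G0| <= 100 * #|G|)%N -> (0 < #|G|)%N ->
  [disjoint I & fst @: A] -> (#|I| <= n - #|A|)%N ->
  [disjoint I & fst @: B] -> (#|I| <= n - #|B|)%N -> (499 * n <= 500 * #|I|)%N ->
  exists s u, [/\ s \in F, u \in G & forall i, i \in I -> s i != u i].
Proof.
move=> n1000 gF FF0 Fc F0' gG GG0 Gc G0' IA IAn IB IBn In.
have [/existsP[s /existsP[u /and3P[sF uG /forall_inP H]]]|no] := boolP [exists s,
  exists u, [&& s \in F, u \in G & [forall (i | i \in I), s i != u i]]].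
  by exists s, u.
exfalso.
have QF := diag_lt2 n1000 gF FF0 Fc F0' IA IAn In.
have QG := diag_lt2 n1000 gG GG0 Gc G0' IB IBn In.
pose rho (i : 'I_n) : R := if i \in I then n.-1%:R^-1 else 0.
pose ind (H : {set {perm 'I_n}}) (s : {perm 'I_n}) : R := (s \in H)%:R / #|H|%:R.
have rho0 i : 0 <= rho i by rewrite /rho; case: ifP; rewrite ?invr_ge0 ?ler0n.
have ind1 (H : {set {perm 'I_n}}) : (0 < #|H|)%N -> \sum_s ind H s = 1.
  move=> H0; rewrite -mulr_suml -natr_sum -big_mkcond sum1_card divff //.
  by rewrite pnatr_eq0 -lt0n.
have prodI (c : R) s u : \prod_i (1 + c * rho i * zker R (s i) (u i)) =
    \prod_(i in I) (1 + c * n.-1%:R^-1 * zker R (s i) (u i)).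
  rewrite [RHS]big_mkcond; apply: eq_bigr => i _; rewrite /rho.
  by case: (i \in I); rewrite // mulr0 mul0r addr0.
have indE (H : {set {perm 'I_n}}) (K : {perm 'I_n} -> {perm 'I_n} -> R) :
    \sum_s \sum_u ind H s * ind H u * K s u = (\sum_(s in H) \sum_(u in H) K s u) / #|H|%:R ^+ 2.
  rewrite mulr_suml [RHS]big_mkcond; apply: eq_bigr => s _; rewrite /ind.
  case: (s \in H); last by rewrite big1 // => u _; rewrite !mul0r.
  rewrite mulr_suml [RHS]big_mkcond; apply: eq_bigr => u _.
  by case: (u \in H); rewrite ?mul0r ?mulr0 ?mul0r // !mul1r expr2 invfM mulrC.
have := cross_sum_ge rho0 (ind1 F F0') (ind1 G G0').
rewrite big1 => [|s _]; last first.
  apply: big1 => u _; rewrite /ind.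
  case: (boolP (s \in F)) => sF; last by rewrite !mul0r.
  case: (boolP (u \in G)) => uG; last by rewrite !(mul0r, mulr0).
  move: no; rewrite negb_exists => /forallP /(_ s).
  rewrite negb_exists => /forallP /(_ u); rewrite sF uG negb_forall_in /=.
  case/exists_inP => i iI; rewrite negbK => /eqP su.
  rewrite (bigD1 i) //= /rho iI /zker su eqxx mulr1.
  have n1 : n.-1%:R = n%:R - 1 :> R by rewrite -subn1 natrB // (leq_trans _ n1000).
  have nR : 1000 <= n%:R :> R by rewrite ler_nat.
  by rewrite -n1 mulVf ?subrr ?mul0r ?mulr0 // n1 gt_eqF //; lra.
have plus (H : {set {perm 'I_n}}) :
    \sum_s \sum_u ind H s * ind H u * \prod_i (1 + rho i * zker R (s i) (u i)) =
    (\sum_(s in H) \sum_(u in H) \prod_(i in I) (1 + n.-1%:R^-1 * zker R (s i) (u i))) / #|H|%:R ^+ 2.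
  rewrite -indE; apply: eq_bigr => s _; apply: eq_bigr => u _; congr (_ * _).
  have := prodI 1 s u; under eq_bigr => i _ do rewrite mul1r.
  by under [RHS]eq_bigr => i _ do rewrite mul1r.
rewrite !plus add0r => H.
have qF : (\sum_(s in F) \sum_(u in F) \prod_(i in I) (1 + n.-1%:R^-1 * zker R (s i) (u i))) / #|F|%:R ^+ 2 < 2.
  by rewrite ltr_pdivrMr // exprn_gt0 // ltr0n.
have qG : (\sum_(s in G) \sum_(u in G) \prod_(i in I) (1 + n.-1%:R^-1 * zker R (s i) (u i))) / #|G|%:R ^+ 2 < 2.
  by rewrite ltr_pdivrMr // exprn_gt0 // ltr0n.
by lra.
Qed.

End DisjointPair.

(** * Pairs with a prescribed number of agreements *)

Lemma card_scale_gt0 (a b : nat) : (99 * a <= 100 * b -> 0 < a -> 0 < b)%N.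
Proof. lia. Qed.

Lemma row_count_arith (n M a b i : nat) : (1000 * M <= n)%N -> (a <= M)%N ->
  (b <= M)%N -> (n <= i + (a + b))%N -> (499 * n <= 500 * i)%N.
Proof. lia. Qed.

Lemma size_lt_arith (n M a : nat) :
  (2000 <= n)%N -> (1000 * M <= n)%N -> (a <= M)%N -> (a < n)%N.
Proof. lia. Qed.

Lemma two_sizes_arith (n M a b : nat) : (2000 <= n)%N -> (1000 * M <= n)%N ->
  (a <= M)%N -> (b <= M)%N -> ~ (n <= a + b)%N.
Proof. lia. Qed.

Lemma pigeon_arith (n a b u i : nat) : (n < 2 * a)%N -> (n < 2 * b)%N ->
  (u <= n)%N -> (u + i = a + b)%N -> (0 < i)%N.
Proof. lia. Qed.

Lemma sub_size_arith (n M a m : nat) : (2000 <= n)%N -> (1000 * M <= n)%N ->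
  (a <= M)%N -> (m <= 2)%N -> (998 * n <= 1000 * (n - (a + m)))%N.
Proof. lia. Qed.

Lemma scale_trans_arith (a b c d : nat) :
  (99 * a <= 100 * b)%N -> (b <= 10 * c * d)%N -> (99 * a <= 1000 * (c * d))%N.
Proof. lia. Qed.

Lemma chain_arith (R : realFieldType) (e e15 m p q c : R) : 0 < m -> 0 < e ->
  26 <= e15 -> e15 * e <= m * p -> p <= c * q -> c <= 26 -> 0 <= q -> e <= m * q.
Proof.
move=> m0 e0 h15 h hp hc q0; rewrite -(@ler_pM2l _ 26); last by lra.
apply: le_trans (ler_wpM2r (ltW e0) h15) _; apply: le_trans h _.
rewrite mulrCA ler_pM2l //; apply: le_trans hp _.
exact: ler_wpM2r.
Qed.

(** Adding a point costs a factor 13 in [add_point], and [regularize] another 2; this fixes the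
    budget of [r ^+ 15] per point. *)
Lemma pow15_ge (R : realFieldType) : 26 <= (5 / 4) ^+ 15 :> R.
Proof. by lra. Qed.

Lemma half_arith (R : realFieldType) (x g f : R) : x <= 1 / 2 -> 0 <= g ->
  (1 - x) * g <= f -> g <= 2 * f.
Proof. by move=> h g0 H; have := ler_wpM2r g0 h; lra. Qed.

Lemma small_prod_arith (R : realFieldType) (c n d : R) : 0 < n -> c <= 500 ->
  0 <= d -> 1000 * d <= n -> c / n * d <= 1 / 2.
Proof.
move=> n0 c500 d0 dn; rewrite mulrAC ler_pdivrMr //.
have := ler_wpM2r d0 c500; lra.
Qed.

Section ExactAgreement.
Context (R : realType) (n M : nat).
Hypotheses (n2000 : (2000 <= n)%N) (nM : (1000 * M <= n)%N).
Implicit Types (s u : {perm 'I_n}) (F G : {set {perm 'I_n}}).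
Implicit Types (A B D : {set 'I_n * 'I_n}) (x y : 'I_n * 'I_n).

Let r : R := 5 / 4.
Let r0 : 0 < r. Proof. by rewrite /r; lra. Qed.
Let r1 : 1 < r. Proof. by rewrite /r; lra. Qed.
Let nR' : 2000 <= n%:R :> R. Proof. by rewrite ler_nat. Qed.

Lemma sub_size A (m : nat) : (#|A| <= M)%N -> (m <= 2)%N ->
  n%:R * (998 / 1000) <= (n - (#|A| + m))%:R :> R.
Proof.
move=> AM m2; have := sub_size_arith n2000 nM AM m2.
by rewrite -(ler_nat R) !natrM => H; lra.
Qed.

Lemma glob_singleR F A y : (#|A| <= M)%N -> glob r A F -> y \notin A ->
  #|fam F [set y]|%:R <= 126 / 100 / n%:R * #|F|%:R :> R.
Proof.
have nR := nR'.
move=> AM gF yA; have := glob_single r0 gF yA.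
have := sub_size AM (leq0n 2); rewrite addn0 => H1 H2.
rewrite mulrAC ler_pdivlMr; last by lra.
have F0 : 0 <= #|F|%:R :> R by [].
have f0 : 0 <= #|fam F [set y]|%:R :> R by [].
have := ler_wpM2l f0 H1; rewrite /r in H2; lra.
Qed.

(** [D] has at most [n / 1000] points, and each lies on a share of at most 1.26 / n of [F]. *)
Lemma avoid_card F A D : (#|A| <= M)%N -> (#|D| <= M)%N -> glob r A F ->
  [disjoint D & A] -> (99 * #|F| <= 100 * #|few_hits F D 0|)%N.
Proof.
have nR := nR'.
move=> AM DM gF DA.
have pD y : y \in D -> #|fam F [set y]|%:R <= 126 / 100 / n%:R * #|F|%:R :> R.
  by move=> yD; apply: (@glob_singleR _ A) => //; rewrite (disjointFr DA).
have := few_hits_card 0 pD; rewrite divr1 => H.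
have DR : 1000 * #|D|%:R <= n%:R :> R.
  by rewrite -natrM ler_nat (leq_trans _ nM) // leq_mul2l DM.
have : 126 / 100 / n%:R * #|D|%:R <= 2 / 1000 :> R.
  by rewrite mulrAC ler_pdivrMr; lra.
have F0 : 0 <= #|F|%:R :> R by [].
move=> /(ler_wpM2r F0) H2.
by rewrite -(ler_nat R) !natrM; lra.
Qed.

(** The columns with a share below 1 / (10 n) carry at most a tenth of [F2], and no column carries
    more than 1.28 / n. So more than 0.9 / 1.28 of the columns remain, and two such sets of columns
    must meet. *)
Lemma good_columns F F2 A i : (#|A| <= M)%N -> glob r A F -> F2 \subset F ->
  (99 * #|F| <= 100 * #|F2|)%N -> (0 < #|F2|)%N -> i \notin fst @: A ->
  (n < 2 * #|[set j | (#|F2| <= 10 * n * #|fam F2 [set (i, j)]|)%N]|)%N.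
Proof.
have nR := nR'.
move=> AM gF F2F F2c F20 iA; set J := [set j | _].
have F2R : 0 < #|F2|%:R :> R by rewrite ltr0n.
have FF2 : #|F|%:R <= 100 / 99 * #|F2|%:R :> R.
  by move: F2c; rewrite -(ler_nat R) !natrM => H; lra.
have up j : #|fam F2 [set (i, j)]|%:R <= 128 / 100 / n%:R * #|F2|%:R :> R.
  apply: (@le_trans _ _ #|fam F [set (i, j)]|%:R).
    by rewrite ler_nat subset_leq_card ?famS.
  have ijA : (i, j) \notin A by apply: contra iA => /(imset_f fst).
  apply: le_trans (glob_singleR AM gF ijA) _.
  rewrite -[_ / n%:R * _]mulrAC -[128 / _ / _ * _]mulrAC ler_pM2r ?invr_gt0; last by lra.
  by lra.
have := card_row_sum F2 i => /(congr1 (fun m => m%:R : R)) /=.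
rewrite natr_sum (bigID (mem J)) /=.
have s1 : \sum_(j in J) #|fam F2 [set (i, j)]|%:R <= 128 / 100 / n%:R * #|F2|%:R * #|J|%:R :> R.
  by rewrite mulr_natr -sumr_const; apply: ler_sum => j _; apply: up.
have s2 : \sum_(j | j \notin J) #|fam F2 [set (i, j)]|%:R <= 1 / 10 * #|F2|%:R :> R.
  apply: (@le_trans _ _ (\sum_(j < n) 1 / 10 / n%:R * #|F2|%:R)).
    rewrite [leRHS](bigID (mem J)) /= -[leLHS]add0r; apply: lerD.
      by apply: sumr_ge0 => j _; rewrite !mulr_ge0 ?invr_ge0.
    apply: ler_sum => j; rewrite inE -ltnNge => /ltnW; rewrite -(ler_nat R) !natrM => H.
    by rewrite mulrAC ler_pdivlMr; lra.
  have sumc (c : R) : \sum_(j < n) c = c * n%:R by rewrite sumr_const card_ord mulr_natr.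
  rewrite sumc mulrAC divfK //; last by rewrite gt_eqF //; lra.
move=> E; have {E s1 s2} : 9 / 10 * #|F2|%:R <= 128 / 100 / n%:R * #|F2|%:R * #|J|%:R :> R.
  by lra.
rewrite [leRHS]mulrAC ler_pM2r // mulrAC ler_pdivlMr; last by lra.
by move=> H; rewrite -(ltr_nat R) natrM; lra.
Qed.

(** The family shrinks by at most about 10 n, against a normalisation close to [n], which gives the
    13. The second conclusion replaces the globality lost by restricting: it suffices to thin the
    family once more before regularising. *)
Lemma add_point F F2 A x : (#|A| <= M)%N -> glob r A F -> F2 \subset F ->
  (99 * #|F| <= 100 * #|F2|)%N -> x.1 \notin fst @: A ->
  (#|F2| <= 10 * n * #|fam F2 [set x]|)%N ->
  pot r A F <= 13 * pot r (x |: A) (fam F2 [set x]) /\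
  (forall y, y \notin x |: A ->
     #|fam (fam F2 [set x]) [set y]|%:R <= 16 / n%:R * #|fam F2 [set x]|%:R :> R).
Proof.
have nR := nR'.
move=> AM gF F2F F2c x1A F2x; have [FA _] := gF.
have xA : x \notin A by apply: contra x1A => /(imset_f fst).
have F3R : 99 * #|F|%:R <= 1000 * (n%:R * #|fam F2 [set x]|%:R) :> R.
  by rewrite -!natrM ler_nat (scale_trans_arith F2c).
have F0 : 0 <= #|F|%:R :> R by [].
have n0 : 0 < n%:R :> R by lra.
split=> [|y yA].
  rewrite /pot (densE _ FA) densE; last first.
    move=> s /mem_fam[/(subsetP F2F)/FA As xs].
    by rewrite subUset xs.
  rewrite cardsU1 xA add1n exprS.
  have An : (#|A| < n)%N := size_lt_arith n2000 nM AM.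
  have -> : (n - #|A|)`!%:R = (n - #|A|)%:R * (n - #|A|.+1)`!%:R :> R.
    by rewrite -natrM -(subnSK An) factS.
  have f0 := fact_gt0R R (n - #|A|.+1)%N.
  have e0 := exprn_gt0 #|A| r0.
  have m0 := sub_size AM (leq0n 2); rewrite addn0 in m0.
  have m1 : 0 < (n - #|A|)%:R :> R by lra.
  set m : R := (n - #|A|)%:R in m0 m1 *; set f : R := _`!%:R in f0 *.
  set e := r ^+ _ in e0 *; set c : R := #|fam _ _|%:R in F3R *.
  have c0 : 0 <= c by rewrite /c.
  rewrite ler_pdivrMr // ler_pdivrMr ?mulr_gt0 //.
  have -> : 13 * (c / f / (r * e)) * e * (m * f) = 13 / r * (c * m).
    by field; rewrite !gt_eqF.
  rewrite /r; have := ler_wpM2l c0 m0; lra.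
have := glob_pair r0 gF xA yA.
have h2 := sub_size AM (leqnn 2); have h1 := sub_size AM (leq0n 2).
rewrite addn0 in h1.
have h3 : n%:R * (998 / 1000) <= (n - #|A|.+1)%:R :> R.
  by have := sub_size AM (leqnSn 1); rewrite addn1.
have sub : #|fam (fam F2 [set x]) [set y]|%:R <= #|fam F [set x; y]|%:R :> R.
  by rewrite famU ler_nat subset_leq_card ?famS.
set c : R := #|fam F [set x; y]|%:R in sub *; set d : R := #|fam F2 [set x]|%:R in F3R *.
have c0 : 0 <= c by rewrite /c.
have n9 : 0 <= n%:R * (998 / 1000) :> R by lra.
have := ler_wpM2l c0 (ler_pM n9 n9 h1 h3) => H1 H2.
rewrite mulrAC ler_pdivlMr //.
have : c * (n%:R * (998 / 1000) * (n%:R * (998 / 1000))) <= (25 / 16) * (1000 / 99 * (n%:R * d)).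
  by rewrite /r in H2; lra.
have -> : c * (n%:R * (998 / 1000) * (n%:R * (998 / 1000))) = (998 / 1000) ^+ 2 * (c * n%:R) * n%:R by ring.
have -> : 25 / 16 * (1000 / 99 * (n%:R * d)) = (25 / 16) * (1000 / 99) * d * n%:R by field.
rewrite ler_pM2r // => H3.
have d0 : 0 <= d by rewrite /d.
by apply: le_trans (ler_wpM2r (ltW n0) sub) _; lra.
Qed.



(** [F] is thinned to avoid [B :\: A] and [G] to avoid [A :\: B], then a pair disagreeing off the
    rows of both sets is taken. In a row of [A] the member of [F] is determined by [A], so a common
    point there lies in [A], and by the thinning also in [B]; rows of [B] are symmetric. *)
Lemma exact_agreement_base F G A B : (#|A| <= M)%N -> (#|B| <= M)%N ->
  glob r A F -> glob r B G -> (0 < #|F|)%N -> (0 < #|G|)%N ->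
  exists s u, [/\ s \in F, u \in G & gr s :&: gr u = A :&: B].
Proof.
move=> AM BM gF gG F0 G0; have [FA _] := gF; have [GB _] := gG.
have [s0 s0F] : exists s, s \in F by apply/set0Pn; rewrite -card_gt0.
have [u0 u0G] : exists u, u \in G by apply/set0Pn; rewrite -card_gt0.
have BAM : (#|B :\: A| <= M)%N by rewrite (leq_trans _ BM) // subset_leq_card ?subsetDl.
have ABM : (#|A :\: B| <= M)%N by rewrite (leq_trans _ AM) // subset_leq_card ?subsetDl.
have dBA : [disjoint B :\: A & A] by rewrite -setI_eq0 setIDAC setDIl setDv setI0.
have dAB : [disjoint A :\: B & B] by rewrite -setI_eq0 setIDAC setDIl setDv setI0.
have F2c := avoid_card AM BAM gF dBA; have G2c := avoid_card BM ABM gG dAB.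
set F2 := few_hits F _ 0 in F2c; set G2 := few_hits G _ 0 in G2c.
have dA := card_dom (FA _ s0F); have dB := card_dom (GB _ u0G).
pose I := ~: ((fst @: A) :|: (fst @: B)).
have Ic : (n <= #|I| + (#|A| + #|B|))%N.
  rewrite -[leqLHS](card_ord n) -(cardsC (fst @: A :|: fst @: B)) addnC leq_add2l.
  by rewrite -dA -dB; apply: leq_card_setU.
have IA : [disjoint I & fst @: A] by rewrite disjoints_subset setCS subsetUl.
have IB : [disjoint I & fst @: B] by rewrite disjoints_subset setCS subsetUr.
have disj_size (D : {set 'I_n * 'I_n}) : #|fst @: D| = #|D| ->
    [disjoint I & fst @: D] -> (#|I| <= n - #|D|)%N.
  move=> dD ID; rewrite -dD leq_subRL; last by rewrite -[leqRHS]card_ord max_card.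
  have := cardsUI I (fst @: D); rewrite (disjoint_setI0 ID) cards0 addn0 addnC => <-.
  by rewrite -[leqRHS]card_ord max_card.
have n1000 : (1000 <= n)%N by apply: leq_trans n2000.
have In := row_count_arith nM AM BM Ic.
have F20 := card_scale_gt0 F2c F0.
have G20 := card_scale_gt0 G2c G0.
have F2F : F2 \subset F := few_hits_sub _ _ _.
have G2G : G2 \subset G := few_hits_sub _ _ _.
have [s [u [sF2 uG2 su]]] := disagree_exists n1000 gF F2F F2c F20 gG G2G G2c G20
  IA (disj_size _ dA IA) IB (disj_size _ dB IB) In.
have sF := subsetP F2F _ sF2; have uG := subsetP G2G _ uG2.
exists s, u; split => //; apply/setP => y; apply/idP/idP; last first.
  by case/setIP => yA yB; rewrite inE (subsetP (FA _ sF) _ yA) (subsetP (GB _ uG) _ yB).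
case/setIP => ys yu.
have avoid (C E : {set 'I_n * 'I_n}) H v : v \in few_hits H (C :\: E) 0 -> y \in gr v -> y \in C -> y \in E.
  rewrite inE leqn0 cards_eq0 => /andP[_ /eqP/setP/(_ y)].
  by rewrite in_set0 in_setI in_setD => + yv yC; rewrite yv yC andbT; case: (y \in E).
have AB : y \in A = (y \in B).
  by apply/idP/idP => [|] yC; [apply: avoid uG2 yu yC|apply: avoid sF2 ys yC].
rewrite in_setI AB andbb.
case: (boolP (y.1 \in I)) => [yI|].
  have := su _ yI; move: ys yu; rewrite !inE => /eqP -> /eqP ->.
  by rewrite eqxx.
rewrite inE negbK in_setU => /orP[] /imsetP[z zC yz].
  have zs := subsetP (FA _ sF) _ zC; rewrite -AB.
  suff -> : y = z by [].
  move: ys zs yz; rewrite !inE; case: (y) (z) => [y1 y2] [z1 z2] /= /eqP <- /eqP <- ->.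
  by [].
have zs := subsetP (GB _ uG) _ zC.
suff -> : y = z by [].
move: yu zs yz; rewrite !inE; case: (y) (z) => [y1 y2] [z1 z2] /= /eqP <- /eqP <- ->.
by [].
Qed.

(* A row in which both families see more than half of the columns provides a
   common point; adding it costs a bounded factor, and the families are then made
   global again above disjoint sets of new points. *)
Lemma exact_agreement k F G A B : glob r A F -> glob r B G ->
  r ^+ (15 * k) <= r ^+ M * pot r A F -> r ^+ (15 * k) <= r ^+ M * pot r B G ->
  exists s u, [/\ s \in F, u \in G & #|gr s :&: gr u| = (#|A :&: B| + k)%N].
Proof.
have nR := nR'; have rM := exprn_gt0 M r0.
(* The budget [r ^+ (15 * j)] is at least 1, so the potential alone keeps every set within [M]
   points throughout the induction. *)
have size0 A' F' (j : nat) : r ^+ (15 * j) <= r ^+ M * pot r A' F' -> (#|A'| <= M)%N.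
  move=> H; apply: (@pot_size R n r A' F') => //; rewrite -div1r ler_pdivrMr // mulrC.
  by apply: le_trans H; rewrite exprn_ege1 // ltW.
have pos0 A' F' (j : nat) : r ^+ (15 * j) <= r ^+ M * pot r A' F' -> 0 < pot r A' F'.
  by move=> /(lt_le_trans (exprn_gt0 _ r0)); rewrite pmulr_rgt0.
have card0 A' F' : 0 < pot r A' F' -> (0 < #|F'|)%N.
  by move=> /(pot_gt0 r0)[s sF _]; apply/card_gt0P; exists s.
elim: k F G A B => [|k IHk] F G A B gF gG hF hG.
  have [s [u [sF uG su]]] := exact_agreement_base (size0 _ _ _ hF) (size0 _ _ _ hG) gF gG
    (card0 _ _ (pos0 _ _ _ hF)) (card0 _ _ (pos0 _ _ _ hG)).
  by exists s, u; rewrite su addn0.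
have AM := size0 _ _ _ hF; have BM := size0 _ _ _ hG.
have F0 := card0 _ _ (pos0 _ _ _ hF); have G0 := card0 _ _ (pos0 _ _ _ hG).
have [FA _] := gF; have [GB _] := gG.
have BAM : (#|B :\: A| <= M)%N by rewrite (leq_trans _ BM) // subset_leq_card ?subsetDl.
have ABM : (#|A :\: B| <= M)%N by rewrite (leq_trans _ AM) // subset_leq_card ?subsetDl.
have dBA : [disjoint B :\: A & A] by rewrite -setI_eq0 setIDAC setDIl setDv setI0.
have dAB : [disjoint A :\: B & B] by rewrite -setI_eq0 setIDAC setDIl setDv setI0.
have F2c := avoid_card AM BAM gF dBA; have G2c := avoid_card BM ABM gG dAB.
set F2 := few_hits F _ 0 in F2c; set G2 := few_hits G _ 0 in G2c.
have F20 := card_scale_gt0 F2c F0.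
have G20 := card_scale_gt0 G2c G0.
have F2F : F2 \subset F := few_hits_sub _ _ _.
have G2G : G2 \subset G := few_hits_sub _ _ _.
have [i iAB] : exists i, i \notin (fst @: A) :|: (fst @: B).
  apply/existsP; rewrite -negb_forall; apply: contraL n2000 => /forallP iAB.
  have nU : n = #|fst @: A :|: fst @: B|.
    by rewrite -[LHS](card_ord n) -cardsT; apply/eq_card => i; rewrite iAB inE.
  apply/negP => _; apply: (@two_sizes_arith n M #|A| #|B|) => //.
  rewrite [leqLHS]nU; apply: leq_trans (leq_card_setU _ _) _.
  by apply: leq_add; apply: leq_imset_card.
move: iAB; rewrite in_setU negb_or => /andP[iA iB].
have JF := good_columns AM gF F2F F2c F20 iA.
have JG := good_columns BM gG G2G G2c G20 iB.
set J1 := [set j | _] in JF; set J2 := [set j | _] in JG.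
have [j /setIP[jJ1 jJ2]] : exists j, j \in J1 :&: J2.
  apply/set0Pn; rewrite -card_gt0.
  have := cardsUI J1 J2; have := max_card (mem (J1 :|: J2)); rewrite card_ord; exact: pigeon_arith JF JG.
pose x := (i, j).
have xA : x \notin A by apply: contra iA => /(imset_f fst).
have xB : x \notin B by apply: contra iB => /(imset_f fst).
move: jJ1 jJ2; rewrite !inE => xF xG.
have [pF sF] := @add_point _ _ _ x AM gF F2F F2c iA xF.
have [pG sG] := @add_point _ _ _ x BM gG G2G G2c iB xG.
set F3 := fam F2 [set x] in pF sF; set G3 := fam G2 [set x] in pG sG.
have F3A s : s \in F3 -> x |: A \subset gr s.
  by case/mem_fam => /(subsetP F2F)/FA As xs; rewrite subUset xs.
have G3B s : s \in G3 -> x |: B \subset gr s.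
  by case/mem_fam => /(subsetP G2G)/GB Bs xs; rewrite subUset xs.
have pF3 : 0 < pot r (x |: A) F3.
  by have := lt_le_trans (pos0 _ _ _ hF) pF; rewrite pmulr_rgt0 // ltr0n.
have pG3 : 0 < pot r (x |: B) G3.
  by have := lt_le_trans (pos0 _ _ _ hG) pG; rewrite pmulr_rgt0 // ltr0n.
have r15 : 26 <= r ^+ 15 := pow15_ge R.
have e0 := exprn_gt0 (15 * k) r0.
have c13 : 13 <= 26 :> R by rewrite ler_nat.
move: hF hG; rewrite mulnS (exprD _ 15 (15 * k)) => hF hG.
have hits s : s \in F3 -> (#|gr s :&: ((x |: B) :\: (x |: A))| <= 0)%N.
  case/mem_fam; rewrite inE => /andP[_] + _; apply: leq_trans.
  apply/subset_leq_card/setIS/subsetP => y; rewrite !inE negb_or.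
  by case/andP => /andP[/negbTE -> ->].
have few D : x |: A \subset D -> pot r (x |: A) F3 <= pot r D F3 ->
    #|G3|%:R <= 2 * #|few_hits G3 (D :\: (x |: B)) 0|%:R :> R.
  move=> AD pD; have DM : (#|D| <= M)%N.
    apply: (@size0 D F3 k); apply: le_trans (_ : r ^+ M * pot r (x |: A) F3 <= _); last first.
      by rewrite ler_pM2l.
    exact: chain_arith rM e0 r15 hF pF c13 (ltW pF3).
  have := @few_hits_card R n G3 (D :\: (x |: B)) 0 (16 / n%:R).
  have sG' y : y \in D :\: (x |: B) -> #|fam G3 [set y]|%:R <= 16 / n%:R * #|G3|%:R :> R.
    by rewrite inE => /andP[yB _]; apply: sG.
  move=> /(_ sG'); rewrite divr1; apply: half_arith => //.
  apply: small_prod_arith; rewrite ?ler0n ?ler_nat //.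
    by rewrite ltr0n (leq_trans _ n2000).
  rewrite -natrM ler_nat (leq_trans _ nM) // leq_mul2l (leq_trans _ DM) //.
  by rewrite subset_leq_card ?subsetDl.
have [A1 [B1 [F1 [G1 [[AA1 BB1 F13 G13] [gF1 gG1] [p1 p2] cAB]]]]] :=
  regularize r0 F3A G3B hits pF3 pG3 few.
have q1 : 0 <= pot r A1 F1 by apply: le_trans (ltW pF3) p1.
have q2 : 0 <= pot r B1 G1.
  by have := le_trans (ltW pG3) p2; rewrite pmulr_rge0 // ltr0n.
have [||s [u [sF1 uG1 su]]] := IHk F1 G1 A1 B1 gF1 gG1.
- apply: chain_arith rM e0 r15 hF _ c13 q1.
  by apply: le_trans pF _; rewrite ler_pM2l // ltr0n.
- apply: chain_arith rM e0 r15 hG _ (lexx 26) q2.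
  by apply: le_trans pG _; rewrite (natrM _ 13 2) -mulrA ler_pM2l // ltr0n.
exists s, u; split.
- by apply: (subsetP F2F); have /mem_fam[] := subsetP F13 _ sF1.
- by apply: (subsetP G2G); have /mem_fam[] := subsetP G13 _ uG1.
have c1 : #|x |: A :&: B| = #|A :&: B|.+1 by rewrite cardsU1 inE negb_and xA.
have c2 : (#|A :&: B|.+1 <= #|A1 :&: B1|)%N.
  by rewrite -c1 setUIr subset_leq_card ?setISS.
(* With both hit bounds 0, regularising creates no common point, so [x] is the only one gained. *)
move: cAB; rewrite -setUIr c1 !addn0 => cAB.
by rewrite su addnS -addSn; congr addn; apply/eqP; rewrite eqn_leq cAB c2.
Qed.

End ExactAgreement.

(** * Maximal restrictions of two cross-avoiding families *)

Lemma bin_le_exp (N k : nat) : ('C(N, k) <= N ^ k)%N.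
Proof.
apply: (@leq_trans (N ^_ k)); first by rewrite -bin_ffact leq_pmulr ?fact_gt0.
elim: k => // k IHk; rewrite ffactnSr expnSr leq_mul //; exact: leq_subr.
Qed.

Lemma fact_sub_le (n t j : nat) : (j <= t)%N -> (t <= n)%N ->
  ((n - (t - j))`! <= n ^ j * (n - t)`!)%N.
Proof.
move=> jt tn; have -> : (n - (t - j) = j + (n - t))%N by lia.
have : (j + (n - t) <= n)%N by lia.
elim: j {jt} => [|j IHj] h; first by rewrite mul1n.
by rewrite addSn factS expnS -mulnA leq_mul // IHj // ltnW.
Qed.

Lemma pow15_le (R : realFieldType) : (5 / 4) ^+ 15 <= 29 :> R.
Proof. by lra. Qed.

(** The choice of [h] balances two needs: allowing [h] hits on either side keeps fewer than [t]
    common points, and [h.+1] is still at least half of [t - c], as Markov's inequality requires. *)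
Lemma hits_arith (t c a h : nat) : (c < t)%N -> h = ((t - c).-1)./2 ->
  (a <= c + h + h)%N -> (t - c <= 2 * h.+1)%N /\ (a < t)%N.
Proof. lia. Qed.

Lemma exponent_arith (t : nat) : (t + t + 3 * t <= 12 * t)%N.
Proof. lia. Qed.

(** Here [a], [b], [c] are the sizes of [A], [B] and [A :&: B], and [d] counts further points at the
    fine scale. *)
Lemma near_arith (t X a b c d i j : nat) : (2 <= X)%N -> (i <= j)%N -> (j <= t)%N ->
  (c <= t - j)%N -> (c <= a)%N -> (c <= b)%N -> (t - i <= a)%N -> (t - j <= b)%N ->
  (d + ((a - (t - i)) + (b - (t - j))) < X * j)%N ->
  ((a - c) + (b - c) + d <= 2 * X * (t - c))%N.
Proof.
move=> X2 ij jt cj ca cb ia jb dK.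
have h1 : (X * j <= X * (t - c))%N by rewrite leq_mul2l; apply/orP; right; lia.
have h2 : (2 * (t - c) <= X * (t - c))%N by rewrite leq_mul2r X2 orbT.
rewrite -mulnA mul2n -addnn; lia.
Qed.

Lemma quadruple_arith (i j : nat) : (i <= j)%N -> (i + j + 2 * j <= 4 * j)%N.
Proof. lia. Qed.

Lemma hits_scale_arith (X c h : nat) : (c <= 2 * h)%N -> (2 * X * c <= 4 * (h * X))%N.
Proof.
by move=> ch; have := leq_mul ch (leqnn X); lia.
Qed.

Lemma cover_scale_arith (X a t : nat) : (a <= 6 * t)%N ->
  (a * (16 * X) * 10 <= 1000 * (t * X))%N.
Proof.
by move=> h; have := leq_mul h (leqnn X); lia.
Qed.

Lemma two_densities_arith (R : realFieldType) (a b : R) : 0 <= a -> a <= 1 -> 0 <= b ->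
  b <= 1 -> 98 / 100 <= a * b -> 98 / 100 <= a /\ 98 / 100 <= b.
Proof.
move=> a0 a1 b0 b1 h; split.
  by have := ler_wpM2l a0 b1; lra.
by have := ler_wpM2r b0 a1; lra.
Qed.

Lemma far_arith (t X c d : nat) : (3 <= X)%N -> (c < t)%N -> (d <= 3)%N ->
  (t - c + (t - c) + d <= 2 * X * (t - c))%N.
Proof.
move=> X3 ct d3; have h : (0 < t - c)%N by rewrite subn_gt0.
have := leq_mul X3 (leqnn (t - c)); lia.
Qed.

Lemma pow54_small (R : realFieldType) (d : nat) (a : R) : 98 / 100 <= a ->
  (5 / 4) ^+ d * a <= 2 -> (d <= 3)%N.
Proof.
move=> ha h; rewrite leqNgt; apply/negP => d4.
have r1 : 1 <= 5 / 4 :> R by lra.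
have := ler_weXn2l r1 d4; have p0 : 0 <= (5 / 4) ^+ d :> R by rewrite exprn_ge0 //; lra.
have := ler_wpM2l p0 ha; lra.
Qed.

Lemma ratio_arith (f p m : nat) : (0 < f)%N -> (99 * f <= 100 * p)%N -> (2 <= m)%N ->
  (f < p * m)%N.
Proof. by move=> f0 h m2; have := leq_mul (leqnn p) m2; lia. Qed.

Lemma main_arith (R : realFieldType) (p p0 a b d f : R) : 0 < f -> 99 * f <= 100 * p ->
  p = p0 + a + b -> a <= d -> b <= f / 1000 -> d <= f / 1000 -> 98 / 100 * f <= p0.
Proof.
by move=> f0 h1 h2 h3 h4 h5; lra.
Qed.

(** * Covers and densities at the two scales *)

Section Scale.
Context (R : realType) (n t M X : nat).
Implicit Types (s u : {perm 'I_n}) (F G : {set {perm 'I_n}}).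
Implicit Types (A B D T : {set 'I_n * 'I_n}).

(* The fine scale [r] is what [exact_agreement] tolerates; the coarse scale [q]
   has order [n / ln n], so that a family global at that scale misses most of a
   set of size [O(ln n)]. *)
Let r : R := 5 / 4.
Let q : R := n%:R / (16 * X%:R).

Hypotheses (n2000 : (2000 <= n)%N) (nM : (1000 * M <= n)%N) (t1 : (1 <= t)%N).
Hypotheses (X3 : (3 <= X)%N) (tX : (1000 * (t * X) <= n)%N).
(** [hX] lets [X] points at the fine scale outweigh six powers of [n], [hM] lets [M] points outweigh
    all losses of size [n ^ O(t)], and [hq] makes a point at the coarse scale worth [n ^ (1/2)]. *)
Hypotheses (hX : n%:R ^+ 6 <= r ^+ X) (hM : n%:R ^+ (12 * t) <= r ^+ M).
Hypothesis (hq : n%:R <= q ^+ 2).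

Let X2 : (2 <= X)%N. Proof. exact: leq_trans X3. Qed.
Let r0 : 0 < r. Proof. by rewrite /r; lra. Qed.
Let r1 : 1 < r. Proof. by rewrite /r; lra. Qed.
Let n0 : 0 < n%:R :> R. Proof. by rewrite ltr0n (leq_trans _ n2000). Qed.
Let n1 : 1 <= n%:R :> R. Proof. by rewrite ler1n (leq_trans _ n2000). Qed.
Let X0 : 0 < X%:R :> R. Proof. by rewrite ltr0n (leq_trans _ X2). Qed.
Let q0 : 0 < q. Proof. by rewrite divr_gt0 // mulr_gt0 // ltr0n. Qed.
Let q2 : 2 <= q.
Proof.
rewrite -(@ler_pXn2r R 2) ?nnegrE ?(ltW q0) ?ler0n //.
by apply: le_trans hq; rewrite -natrX ler_nat; apply: leq_trans n2000.
Qed.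

Definition bulky F : Prop := (n`! <= n ^ (3 * t) * #|F|)%N.

Lemma t_le : (1000 * t <= n)%N.
Proof.
by apply: leq_trans tX; rewrite leq_mul2l /= leq_pmulr // (leq_trans _ X2).
Qed.

Lemma bulky_pot F A : bulky F -> is_max q set0 F A -> n%:R ^- (3 * t) <= pot q A F.
Proof.
move=> bF [_ /(_ set0 (subxx _))]; apply: le_trans.
rewrite /pot dens_set0 cards0 expr0 divr1 ler_pdivlMr ?fact_gt0R // ler_pdivrMl ?exprn_gt0 //.
by rewrite -natrX -natrM ler_nat.
Qed.

Lemma max_size F A : bulky F -> is_max q set0 F A -> (#|A| <= 6 * t)%N.
Proof.
move=> bF mA; apply: (@pot_size R n q A F); first by apply: lt_le_trans q2; rewrite ltr1n.
apply: le_trans (bulky_pot bF mA).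
rewrite lef_pV2 ?posrE ?exprn_gt0 //.
have -> : (6 * t = 2 * (3 * t))%N by rewrite mulnA.
rewrite (exprM q); apply: lerXn2r => //; rewrite nnegrE ?exprn_ge0 ?(ltW q0) ?(ltW n0) //.
Qed.

Lemma bulky_pot_r F A : bulky F -> is_max q set0 F A -> n%:R ^- (3 * t) <= pot r A F.
Proof.
move=> bF mA; apply: le_trans (bulky_pot bF mA) _.
rewrite /pot ler_wpM2l ?dens_ge0 // lef_pV2 ?posrE ?exprn_gt0 //.
apply: lerXn2r; rewrite ?nnegrE ?(ltW q0) ?(ltW r0) //.
by apply: le_trans q2; rewrite /r ler_pdivrMr ?ltr0n // -natrM ler_nat.
Qed.

(** [A] occupies at most half of the rows, so the share is at most [2 * q / n]. *)
Lemma max_single F A y : bulky F -> is_max q set0 F A -> y \notin A ->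
  #|fam (fam F A) [set y]|%:R <= 1 / (8 * X%:R) * #|fam F A|%:R :> R.
Proof.
move=> bF mA yA; have := glob_single q0 (max_glob mA) yA.
have An : (n <= 2 * (n - #|A|))%N.
  by move: (max_size bF mA) (t_le) => h1 h2; clear -h1 h2; lia.
set f := fam _ [set y] => H.
have : #|f|%:R * n%:R <= 2 * (q * #|fam F A|%:R).
  apply: (@le_trans _ _ (#|f|%:R * (2 * (n - #|A|))%:R)).
    by rewrite ler_wpM2l // ler_nat.
  by rewrite natrM mulrCA ler_wpM2l.
have -> : 2 * (q * #|fam F A|%:R) = 1 / (8 * X%:R) * #|fam F A|%:R * n%:R.
  by rewrite /q; field; rewrite gt_eqF.
by rewrite ler_pM2r.
Qed.

(** The average number of hits is at most [c / 4], hence at most [h.+1 / 2]. *)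
Lemma few_hits_half F D h (c : nat) :
  (forall y, y \in D -> #|fam F [set y]|%:R <= 1 / (8 * X%:R) * #|F|%:R :> R) ->
  (#|D| <= 2 * X * c)%N -> (c <= 2 * h.+1)%N ->
  #|F|%:R <= 2 * #|few_hits F D h|%:R :> R.
Proof.
move=> sD Dc ch; have := few_hits_card h sD.
have h0 : 0 < h.+1%:R :> R by rewrite ltr0n.
have : 1 / (8 * X%:R) * #|D|%:R / h.+1%:R <= 1 / 2 :> R.
  rewrite ler_pdivrMr // [leLHS]mulrAC [1 * #|D|%:R]mul1r ler_pdivrMr; last by rewrite mulr_gt0 ?X0 // ltr0n.
  have -> : 1 / 2 * h.+1%:R * (8 * X%:R) = (4 * (h.+1 * X))%:R :> R.
    by rewrite !natrM; field.
  by rewrite ler_nat (leq_trans Dc) // hits_scale_arith.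
by move=> /half_arith; apply.
Qed.


(** Since [r ^+ 15 <= n], the whole budget is at most [n ^+ t]; together with the factor 2 and the
    potential it costs at most [n ^+ (5 * t)]. *)
Lemma pot_enough (p : R) k : (k <= t)%N ->
  n%:R ^- (3 * t) <= 2 * p -> r ^+ (15 * k) <= r ^+ M * p.
Proof.
move=> kt hp.
have r15 : r ^+ (15 * k) <= n%:R ^+ t.
  apply: (@le_trans _ _ (n%:R ^+ k)); last first.
    by rewrite ler_weXn2l.
  rewrite exprM; apply: lerXn2r; rewrite ?nnegrE ?exprn_ge0 ?(ltW r0) ?(ltW n0) //.
  by apply: le_trans (pow15_le R) _; rewrite ler_nat (leq_trans _ n2000).
apply: le_trans r15 _; rewrite -(@ler_pM2l _ 2) ?ltr0n //.
have n2 : 2 <= n%:R ^+ t :> R.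
  apply: (@le_trans _ _ (n%:R ^+ 1)); last by rewrite ler_weXn2l.
  by rewrite expr1 ler_nat (leq_trans _ n2000).
apply: le_trans (_ : n%:R ^+ t * n%:R ^+ t <= _); first by rewrite ler_wpM2r ?exprn_ge0 ?(ltW n0).
rewrite mulrCA; apply: le_trans (ler_wpM2l (exprn_ge0 _ (ltW r0)) hp).
rewrite ler_pdivlMr ?exprn_gt0 // -!exprD; apply: le_trans hM.
by rewrite ler_weXn2l // exponent_arith.
Qed.

(* With [A] and [B] maximal at the coarse scale [q], the fine maximal set built
   above [A] has at most [d] further points; if these were few compared with
   [X * (t - #|A :&: B|)], then the members of [G] would typically miss them, and
   the two fine maximal sets would still share fewer than [t] points. *)
Lemma max_sets_far F G A B : bulky F -> bulky G ->
  (forall s u, s \in F -> u \in G -> #|gr s :&: gr u| <> (t - 1)%N) ->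
  is_max q set0 F A -> is_max q set0 G B -> (#|A :&: B| < t)%N ->
  (forall d, r ^+ d * dens R A F <= 2 ->
     (#|A :\: B| + #|B :\: A| + d <= 2 * X * (t - #|A :&: B|))%N) -> False.
Proof.
move=> bF bG FG mA mB ABt near.
set c := #|A :&: B| in ABt near; pose h := ((t - c).-1)./2.
have [ch _] := hits_arith ABt (erefl h) (leq0n _).
have [FA FAm] := max_glob mA; have [GB GBm] := max_glob mB.
set FA' := fam F A in FA FAm; set GB' := fam G B in GB GBm.
pose F0 := few_hits FA' (B :\: A) h.
have F0F : F0 \subset FA' := few_hits_sub _ _ _.
have F0A s : s \in F0 -> A \subset gr s by move/(subsetP F0F)/FA.
have F0h s : s \in F0 -> (#|gr s :&: (B :\: A)| <= h)%N.
  by rewrite inE => /andP[].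
have near0 := near 0%N; rewrite expr0 mul1r addn0 in near0.
have {}near0 := near0 (le_trans (dens_le1 R A F) (ler1n R 2)).
have F0c : #|FA'|%:R <= 2 * #|F0|%:R :> R.
  apply: (@few_hits_half _ _ _ (t - c)) => //.
    by move=> y; rewrite inE => /andP[yA _]; apply: max_single.
  by apply: leq_trans near0; rewrite leq_addl.
have potF0 : pot r A F <= 2 * pot r A F0.
  rewrite -(pot_famE r F (subxx A)) /pot (densE R F0A) (densE R FA) !mulrA.
  by rewrite !ler_pM2r ?invr_gt0 ?exprn_gt0 ?fact_gt0R.
have densF0 : dens R A F <= 2 * dens R A F0.
  have -> : dens R A F = dens R A FA' by rewrite /dens famU setUid.
  by rewrite (densE R F0A) (densE R FA) mulrA ler_pM2r ?invr_gt0 ?fact_gt0R.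
have nt0 : 0 < n%:R ^- (3 * t) :> R by rewrite invr_gt0 exprn_gt0.
have pF := bulky_pot_r bF mA.
have pG : n%:R ^- (3 * t) <= pot r B GB' by rewrite pot_famE // bulky_pot_r.
have pF0 : 0 < pot r A F0.
  by have := lt_le_trans nt0 (le_trans pF potF0); rewrite pmulr_rgt0 // ltr0n.
have few D : A \subset D -> pot r A F0 <= pot r D F0 ->
    #|GB'|%:R <= 2 * #|few_hits GB' (D :\: B) h|%:R :> R.
  move=> AD pD; apply: (@few_hits_half _ _ _ (t - c)) => //.
    by move=> y; rewrite inE => /andP[yB _]; apply: max_single.
  (* The potential at [D] is at most [r ^- #|D|], so the increment [d] satisfies
     [r ^+ d * dens A F0 <= 1]; thinning [F] to [F0] doubles the bound. *)
  have := near (#|D| - #|A|)%N => H.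
  have {H}: (#|A :\: B| + #|B :\: A| + (#|D| - #|A|) <= 2 * X * (t - c))%N.
    apply: H; apply: le_trans (ler_wpM2l (exprn_ge0 _ (ltW r0)) densF0) _.
    rewrite mulrCA -[leRHS]mulr1 ler_pM2l ?ltr0n //.
    have : pot r A F0 <= r ^- #|D|.
      by apply: le_trans pD _; rewrite /pot ler_pdivrMr ?exprn_gt0 // mulVf ?dens_le1 // expf_neq0 // gt_eqF.
    rewrite /pot ler_pdivrMr ?exprn_gt0 // => H.
    apply: le_trans (ler_wpM2l (exprn_ge0 _ (ltW r0)) H) _.
    rewrite mulrCA -exprD subnK ?subset_leq_card //.
    by rewrite mulVf // expf_neq0 // gt_eqF.
  apply: leq_trans.
  have sub : D :\: B \subset (A :\: B) :|: (D :\: A).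
    by apply/subsetP => y; rewrite !inE; case: (y \in A); case: (y \in B); case: (y \in D).
  apply: leq_trans (subset_leq_card sub) _; apply: leq_trans (leq_card_setU _ _) _.
  by rewrite (cardsDS AD) leq_add2r leq_addr.
have pG0 := lt_le_trans nt0 pG.
have [A1 [B1 [F1 [G1 [[AA1 BB1 F10 G1G] [gF1 gG1] [p1 p2] cAB]]]]] :=
  regularize r0 F0A GB F0h pF0 pG0 few.
have [_ A1B1t] := hits_arith ABt (erefl h) cAB.
pose k := (t - 1 - #|A1 :&: B1|)%N.
have kE : (#|A1 :&: B1| + k = t - 1)%N by rewrite subnKC // -ltnS subn1 prednK.
have kt : (k <= t)%N by rewrite (leq_trans (leq_subr _ _)) ?leq_subr.
have [||s [u [sF1 uG1 su]]] := exact_agreement n2000 nM gF1 gG1 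
  (pot_enough kt _) (pot_enough kt _).
- by apply: le_trans pF _; apply: le_trans potF0 _; rewrite ler_pM2l ?ltr0n.
- exact: le_trans pG p2.
apply: (FG s u); last by rewrite su kE.
  by have /mem_fam[] := subsetP F0F _ (subsetP F10 _ sF1).
by have /mem_fam[] := subsetP G1G _ uG1.
Qed.

Lemma cover_bound F F' A B m : is_max q set0 F A -> F' \subset F ->
  (forall s, s \in F' -> (m <= #|gr s :&: B|)%N) ->
  #|F'|%:R <= 'C(#|B|, m)%:R * ((n - m)`!%:R * (q ^+ m * pot q A F)).
Proof.
move=> [_ Am] F'F FB; have := card_cover FB; rewrite -(ler_nat R) => /le_trans; apply.
rewrite natr_sum mulr_natl -cards_draws -sumr_const.
rewrite [leRHS](eq_bigl (fun T => (T \subset B) && (#|T| == m))); last by move=> T; rewrite !inE.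
apply: ler_sum => T /andP[_ /eqP Tm].
apply: (@le_trans _ _ #|fam F T|%:R); first by rewrite ler_nat subset_leq_card ?famS.
have := Am T (sub0set _); rewrite [leLHS]/pot /dens Tm.
by rewrite ler_pdivrMr ?exprn_gt0 // ler_pdivrMr ?fact_gt0R // mulrC [pot _ _ _ * _]mulrC.
Qed.


(** As [#|B| <= q / 10], the binomial is at most a power of [q / 10], so each point of [B] beyond
    [t - j] gains a factor 10 over the corresponding power of [q]. *)
Lemma cover_scaled F F' A B j : (#|B| <= 6 * t)%N -> is_max q set0 F A -> F' \subset F ->
  (0 < #|F'|)%N -> (j <= t)%N -> (forall s, s \in F' -> (t - j <= #|gr s :&: B|)%N) ->
  #|F'|%:R <= (q / 10) ^+ (#|B| - (t - j)) * q ^+ (t - j) * n%:R ^+ j * (n - t)`!%:R * pot q A F.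
Proof.
move=> B6 mA F'F F'0 jt FB.
have mB : (t - j <= #|B|)%N.
  have /card_gt0P[s /FB sB] := F'0.
  by apply: leq_trans sB _; rewrite subset_leq_card ?subsetIr.
have pot0 : 0 <= pot q A F by rewrite pot_ge0 ?ltW.
apply: le_trans (cover_bound mA F'F FB) _.
have tn : (t <= n)%N by apply: leq_trans t_le; rewrite leq_pmull.
have Bq : #|B|%:R <= q / 10.
  have : (#|B| * (16 * X) * 10 <= n)%N.
    by apply: leq_trans tX; rewrite (cover_scale_arith X B6).
  rewrite -(ler_nat R) !natrM => H; rewrite /q ler_pdivlMr ?ltr0n // ler_pdivlMr.
    by rewrite mulrAC.
  by rewrite mulr_gt0 ?X0 // ltr0n.
apply: (@le_trans _ _ ((q / 10) ^+ (#|B| - (t - j)) *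
    ((n%:R ^+ j * (n - t)`!%:R) * (q ^+ (t - j) * pot q A F)))); last first.
  rewrite le_eqVlt; apply/orP; left; apply/eqP.
  move: (n%:R ^+ j : R) ((n - t)`!%:R : R) (q ^+ (t - j)) (_ ^+ _) (pot _ _ _).
  by move=> v1 v2 v3 v4 v5; ring.
have qp0 : 0 <= q ^+ (t - j) * pot q A F by rewrite mulr_ge0 // exprn_ge0 // ltW.
apply: ler_pM; [exact: ler0n|by rewrite mulr_ge0 ?ler0n| |].
  rewrite -bin_sub //; apply: (@le_trans _ _ (#|B|%:R ^+ (#|B| - (t - j)))).
    by rewrite -natrX ler_nat bin_le_exp.
  by apply: lerXn2r; rewrite ?nnegrE // divr_ge0 ?(ltW q0).
rewrite ler_wpM2r //.
by rewrite -natrX -natrM ler_nat fact_sub_le.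
Qed.

(** Each family is covered through the maximal set of the other one; the powers of [q] then cancel
    against those in the two potentials and only densities remain. *)
Lemma product_cover F F' G G' A B i j : is_max q set0 F A -> is_max q set0 G B ->
  (#|A| <= 6 * t)%N -> (#|B| <= 6 * t)%N -> F' \subset F -> G' \subset G ->
  (0 < #|F'|)%N -> (0 < #|G'|)%N -> (j <= t)%N -> (i <= t)%N ->
  (forall s, s \in F' -> (t - j <= #|gr s :&: B|)%N) ->
  (forall u, u \in G' -> (t - i <= #|gr u :&: A|)%N) ->
  #|F'|%:R * #|G'|%:R <= (n - t)`!%:R ^+ 2 * n%:R ^+ (i + j) *
    (dens R A F / 10 ^+ ((#|A| - (t - i)) + (#|B| - (t - j)))) * dens R B G.
Proof.
move=> mA mB A6 B6 F'F G'G F'0 G'0 jt it FB GA.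
have hF := cover_scaled B6 mA F'F F'0 jt FB.
have hG := cover_scaled A6 mB G'G G'0 it GA.
have tB : (t - j <= #|B|)%N.
  have /card_gt0P[s /FB sB] := F'0.
  by apply: leq_trans sB _; rewrite subset_leq_card ?subsetIr.
have tA : (t - i <= #|A|)%N.
  have /card_gt0P[s /GA sA] := G'0.
  by apply: leq_trans sA _; rewrite subset_leq_card ?subsetIr.
set wB := (#|B| - (t - j))%N in hF *; set wA := (#|A| - (t - i))%N in hG *.
have split (C : {set 'I_n * 'I_n}) (m : nat) : (m <= #|C|)%N ->
    (q / 10) ^+ (#|C| - m) * q ^+ m = q ^+ #|C| / 10 ^+ (#|C| - m).
  by move=> mC; rewrite expr_div_n mulrAC -exprD subnK.
rewrite split // -/wB in hF; rewrite split // -/wA in hG.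
have qn (C : {set 'I_n * 'I_n}) : q ^+ #|C| != 0 by rewrite expf_neq0 // gt_eqF.
apply: le_trans (ler_pM (ler0n _ _) (ler0n _ _) hF hG) _.
rewrite le_eqVlt; apply/orP; left; apply/eqP; rewrite /pot !exprD.
have t0 (m : nat) : 10 ^+ m != 0 :> R by rewrite expf_neq0 // pnatr_eq0.
have := qn A; have := qn B; have := t0 wA; have := t0 wB.
move: (dens R A F) (dens R B G) (q ^+ #|A|) (q ^+ #|B|) (10 ^+ wA) (10 ^+ wB).
move: (n%:R ^+ i : R) (n%:R ^+ j : R) ((n - t)`!%:R : R).
move=> v1 v2 v3 v4 v5 v6 v7 v8 v9 h9 h8 h7 h6.
by field; rewrite h9 h8 h7 h6.
Qed.

(** If the density of [F] divided by the powers of 10 exceeded [n ^- (4 * j)], the excess sizes and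
    any fine increment would total less than [X * j] by [hX], against [max_sets_far]. So it is at
    most [n ^- (4 * j)], which pays for [n ^+ (i + j)] and for [n ^+ (2 * j)] because [i <= j]. *)
Lemma product_near F G G' A B i j : bulky F -> bulky G ->
  (forall s u, s \in F -> u \in G -> #|gr s :&: gr u| <> (t - 1)%N) ->
  is_max q set0 F A -> is_max q set0 G B -> G' \subset G ->
  (i <= j)%N -> (1 <= j)%N -> (j <= t)%N ->
  (forall s, s \in F -> #|gr s :&: B| = (t - j)%N) ->
  (forall u, u \in G' -> (t - i <= #|gr u :&: A|)%N) ->
  #|F|%:R * #|G'|%:R * n%:R ^+ (2 * j) <= (n - t)`!%:R ^+ 2 :> R.
Proof.
move=> bF bG FG mA mB G'G ij j1 jt FB GA.
have A6 := max_size bF mA; have B6 := max_size bG mB.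
have [G'0|G'0] := posnP #|G'|; first by rewrite G'0 mulr0 mul0r exprn_ge0.
have F0 : (0 < #|F|)%N.
  rewrite lt0n; apply: contraTneq bF => F0; rewrite /bulky F0 muln0.
  by rewrite -ltnNge fact_gt0.
have FB' s : s \in F -> (t - j <= #|gr s :&: B|)%N by move=> /FB ->.
have tB : (t - j <= #|B|)%N.
  have /card_gt0P[s /FB' sB] := F0.
  by apply: leq_trans sB _; rewrite subset_leq_card ?subsetIr.
have tA : (t - i <= #|A|)%N.
  have /card_gt0P[s /GA sA] := G'0.
  by apply: leq_trans sA _; rewrite subset_leq_card ?subsetIr.
set wB := (#|B| - (t - j))%N; set wA := (#|A| - (t - i))%N.
have key : dens R A F / 10 ^+ (wA + wB) <= n%:R ^- (4 * j).
  rewrite leNgt; apply/negP => lt.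
  have cAB : (#|A :&: B| <= t - j)%N.
    have [s sF As] : exists2 s, s \in F & A \subset gr s.
      apply: (pot_gt0 q0); apply: lt_le_trans (bulky_pot bF mA).
      by rewrite invr_gt0 exprn_gt0.
    by rewrite -(FB s sF) subset_leq_card ?setSI.
  have cABt : (#|A :&: B| < t)%N by apply: leq_ltn_trans cAB _; rewrite ltn_subrL j1.
  apply: (max_sets_far bF bG FG mA mB cABt) => d dd.
  rewrite cardsD (cardsD B A) [B :&: A]setIC.
  apply: near_arith X2 ij jt cAB _ _ tA tB _; rewrite ?subset_leq_card ?subsetIl ?subsetIr //.
  rewrite -/wA -/wB -(@ltr_eXn2l _ r) //.
  have nj0 : 0 < n%:R ^+ (4 * j) :> R by rewrite exprn_gt0.
  have H1 : 10 ^+ (wA + wB) < dens R A F * n%:R ^+ (4 * j).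
    by move: lt; rewrite ltr_pdivlMr ?exprn_gt0 ?ltr0n // mulrC ltr_pdivrMr.
  apply: (@lt_le_trans _ _ (2 * n%:R ^+ (4 * j))).
    apply: (@lt_le_trans _ _ (r ^+ d * (dens R A F * n%:R ^+ (4 * j)))); last first.
      by rewrite mulrA ler_pM2r.
    rewrite exprD ltr_pM2l ?exprn_gt0 //; apply: le_lt_trans H1.
    apply: lerXn2r; rewrite ?nnegrE ?ler0n ?(ltW r0) //.
    by rewrite /r ler_pdivrMr ?ltr0n // -natrM ler_nat.
  rewrite (exprM r X); apply: le_trans (_ : (n%:R ^+ 6) ^+ j <= _); last first.
    by apply: lerXn2r; rewrite ?nnegrE ?exprn_ge0 ?(ltW n0) ?(ltW r0).
  rewrite -exprM (_ : 6 * j = 2 * j + 4 * j)%N; last by rewrite -mulnDl.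
  rewrite exprD ler_pM2r //.
  apply: (@le_trans _ _ (n%:R ^+ 1)); last by rewrite ler_weXn2l // muln_gt0 j1.
  by rewrite expr1 ler_nat (leq_trans _ n2000).
have prod := product_cover mA mB A6 B6 (subxx F) G'G F0 G'0 jt (leq_trans ij jt) FB' GA.
rewrite -/wA -/wB in prod.
have e0 : 0 <= dens R A F / 10 ^+ (wA + wB).
  by rewrite divr_ge0 ?dens_ge0 ?exprn_ge0 ?ler0n.
apply: le_trans (ler_wpM2r (exprn_ge0 _ (ltW n0)) prod) _.
move: (dens R A F / _) key e0 {prod} => e key e0.
move: (dens R B G) (dens_ge0 R B G) (dens_le1 R B G) => v v0 v1.
have f20 : 0 <= (n - t)`!%:R ^+ 2 :> R by rewrite exprn_ge0.
move: (_ ^+ 2 : R) f20 => f2 f20.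
rewrite -!mulrA -[leRHS]mulr1; apply: ler_wpM2l; first exact: f20.
apply: (@le_trans _ _ (n%:R ^+ (i + j) * (n%:R ^- (4 * j) * n%:R ^+ (2 * j)))).
  apply: ler_wpM2l; first by rewrite exprn_ge0 ?ltW.
  rewrite mulrA; apply: ler_wpM2r; first by rewrite exprn_ge0 ?ltW.
  by rewrite -[leRHS]mulr1; apply: ler_pM.
rewrite mulrCA mulrC ler_pdivrMr ?exprn_gt0 // mul1r -exprD.
by rewrite ler_weXn2l // quadruple_arith.
Qed.


(** From [#|F| <= n! <= n ^ t * (n - t)!] the family [G] has size at least [(n - t)! / n ^ (2 * t)];
    comparing with [n!] costs a third power [n ^ t]. *)
Lemma bulky_right F G j : (j <= t)%N ->
  ((n - t)`! ^ 2 < #|F| * #|G| * n ^ j)%N -> bulky G.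
Proof.
move=> jt lt; have tn : (t <= n)%N by apply: leq_trans t_le; rewrite leq_pmull.
have nf : (n`! <= n ^ t * (n - t)`!)%N by have := fact_sub_le (leqnn t) tn; rewrite subnn subn0.
have Ff : (#|F| <= n`!)%N by rewrite -[F]fam0 -[n in leqRHS]subn0 -(cards0 ('I_n * 'I_n)%type) card_fam_le.
have f0 : (0 < (n - t)`!)%N by rewrite fact_gt0.
have n_gt0 : (0 < n)%N by apply: leq_trans n2000.
have : ((n - t)`! * (n - t)`! <= (n - t)`! * (n ^ t * (n ^ t * #|G|)))%N.
  apply: leq_trans (ltnW lt) _; apply: leq_trans (_ : n ^ t * (n - t)`! * #|G| * n ^ t <= _)%N.
    by apply: leq_mul; rewrite ?leq_pexp2l // leq_mul2r (leq_trans Ff nf) orbT.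
  by rewrite -!mulnA mulnCA leq_mul2l leq_mul2l [(#|G| * _)%N]mulnC leqnn !orbT.
rewrite leq_mul2l -[_ == 0%N]negbK -lt0n f0 /= => h.
rewrite /bulky (leq_trans nf) // (_ : 3 * t = t + (t + t))%N; last by rewrite addnA addnn -mul2n -mulSnr.
by rewrite !expnD -!mulnA leq_mul2l h orbT.
Qed.

(* Strong induction on [t - j]: the part of [G] meeting the maximal set of [F]
   in [t - i] points with [i > j] is handled by the same statement with the two
   families exchanged, the rest by [product_near]. *)
Lemma product_small j F G B : (1 <= j)%N -> (j <= t)%N ->
  (forall s u, s \in F -> u \in G -> #|gr s :&: gr u| <> (t - 1)%N) ->
  is_max q set0 G B -> (forall s, s \in F -> #|gr s :&: B| = (t - j)%N) ->
  #|F|%:R * #|G|%:R * n%:R ^+ j <= (n - t)`!%:R ^+ 2 :> R.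
Proof.
have [m] := ubnP (t - j)%N; elim: m j F G B => // m IHm j F G B jm j1 jt FG mB FB.
rewrite leNgt; apply/negP => lt.
have ltN : ((n - t)`! ^ 2 < #|F| * #|G| * n ^ j)%N.
  by rewrite -(ltr_nat R) !natrM !natrX.
have bG := bulky_right jt ltN.
have bF : bulky F by apply: (@bulky_right G F j jt); rewrite [(#|G| * _)%N]mulnC.
have [A mA] := exists_max q set0 F.
(* Subtraction is truncated: class 0 collects all members meeting [A] in [t] or more points. *)
pose Gp i := [set u in G | (t - #|gr u :&: A|)%N == i].
have GpG i : Gp i \subset G by apply/subsetP => u; rewrite inE => /andP[].
(* One power of [n] more than claimed is available for each class, and it absorbs the sum over the
   [t.+1] classes. *)
have part i : (i <= t)%N -> #|F|%:R * #|Gp i|%:R * n%:R ^+ j.+1 <= (n - t)`!%:R ^+ 2 :> R.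
  move=> it; have [ij|ji] := leqP i j.
    apply: le_trans (product_near bF bG FG mA mB (GpG i) ij j1 jt FB _).
      by rewrite ler_wpM2l ?mulr_ge0 // ler_weXn2l // mul2n -addnn -addn1 leq_add2l.
    move=> u; rewrite inE => /andP[_ /eqP <-].
    by rewrite leq_subLR addnC -leq_subLR.
  apply: (@le_trans _ _ (#|Gp i|%:R * #|F|%:R * n%:R ^+ i)).
    by rewrite [_ * #|Gp i|%:R]mulrC ler_wpM2l ?mulr_ge0 // ler_weXn2l.
  apply: (IHm i (Gp i) F A) => //.
  - by rewrite ltnS in jm; apply: leq_trans jm; rewrite ltn_sub2l // (leq_trans ji).
  - exact: leq_ltn_trans ji.
  - by move=> u s /(subsetP (GpG i)) uG sF; rewrite setIC; apply: FG.
  move=> u; rewrite inE => /andP[_ /eqP ui]; have i0 : (0 < i)%N by apply: leq_ltn_trans ji.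
  by rewrite -ui subKn // ltnW // -subn_gt0 ui.
have Gsum : (#|G| <= \sum_(i < t.+1) #|Gp i|)%N.
  rewrite -sum1_card (partition_big (fun u => inord (t - #|gr u :&: A|) : 'I_t.+1) xpredT) //=.
  apply: leq_sum => i _; rewrite -sum1_card; apply: eq_leq; apply: eq_bigl => u.
  by rewrite inE -val_eqE /= inordK // ltnS leq_subr.
have tn : (t.+1 <= n)%N by apply: leq_trans t_le; rewrite (leq_trans _ (leq_mul (_ : 2 <= 1000)%N (leqnn t))) // mul2n -addnn -addn1 leq_add2l.
have : #|F|%:R * #|G|%:R * n%:R ^+ j.+1 <= n%:R * (n - t)`!%:R ^+ 2 :> R.
  apply: (@le_trans _ _ (\sum_(i < t.+1) #|F|%:R * #|Gp i|%:R * n%:R ^+ j.+1)).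
    rewrite -mulr_suml -mulr_sumr ler_wpM2r ?exprn_ge0 ?(ltW n0) // ler_wpM2l //.
    by rewrite -natr_sum ler_nat.
  apply: (@le_trans _ _ (\sum_(i < t.+1) (n - t)`!%:R ^+ 2)).
    by apply: ler_sum => i _; apply: part; rewrite -ltnS.
  by rewrite sumr_const card_ord -[leLHS]mulr_natl ler_wpM2r ?exprn_ge0 // ler_nat.
by rewrite exprS mulrCA ler_pM2l // leNgt lt.
Qed.


(** The classes with [i >= 1] lose a factor [n] each and there are [t <= n / 1000] of them, so
    nearly the whole product comes from members meeting the other maximal set in at least [t]
    points. This leaves no slack in [product_cover]. *)
Lemma exists_core F G :
  (forall s u, s \in F -> u \in G -> #|gr s :&: gr u| <> (t - 1)%N) ->
  (99 * (n - t)`! ^ 2 <= 100 * (#|F| * #|G|))%N ->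
  exists T, [/\ #|T| = t, 98 / 100 <= dens R T F & 98 / 100 <= dens R T G].
Proof.
move=> FG FGbig.
have GF u s : u \in G -> s \in F -> #|gr u :&: gr s| <> (t - 1)%N.
  by move=> uG sF; rewrite setIC; apply: FG.
have f0 : (0 < (n - t)`! ^ 2)%N by rewrite expn_gt0 fact_gt0.
have ltN : ((n - t)`! ^ 2 < #|F| * #|G| * n ^ 1)%N.
  by rewrite expn1; apply: ratio_arith FGbig _ => //; apply: leq_trans n2000.
have bG := bulky_right t1 ltN.
have bF : bulky F by apply: (@bulky_right G F 1 t1); rewrite [(#|G| * _)%N]mulnC.
have [A mA] := exists_max q set0 F; have [B mB] := exists_max q set0 G.
have A6 := max_size bF mA; have B6 := max_size bG mB.
pose Fp i := [set s in F | (t - #|gr s :&: B|)%N == i].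
pose Gp i := [set u in G | (t - #|gr u :&: A|)%N == i].
have sumE (H : {set {perm 'I_n}}) (C : {set 'I_n * 'I_n}) :
    #|H|%:R = \sum_(i < t.+1) #|[set u in H | (t - #|gr u :&: C|)%N == i]|%:R :> R.
  rewrite -natr_sum; congr _%:R.
  rewrite -sum1_card (partition_big (fun u => inord (t - #|gr u :&: C|) : 'I_t.+1) xpredT) //=.
  apply: eq_bigr => i _; rewrite -sum1_card; apply: eq_bigl => u.
  by rewrite inE -val_eqE /= inordK // ltnS leq_subr.
set f2 : R := (n - t)`!%:R ^+ 2.
have f20 : 0 < f2 by rewrite exprn_gt0 ?fact_gt0R.
have tail (x : nat -> R) : (forall i, (1 <= i <= t)%N -> x i * n%:R ^+ i <= f2) ->
    \sum_(i < t) x i.+1 <= f2 / 1000.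
  move=> hx; apply: (@le_trans _ _ (\sum_(i < t) f2 / n%:R)).
    apply: ler_sum => i _; rewrite ler_pdivlMr //.
    have [xi|xi] := leP (x i.+1) 0.
      by apply: le_trans (ltW f20); rewrite pmulr_lle0.
    apply: le_trans (hx i.+1 _); last by rewrite /= ltn_ord.
    by rewrite ler_pM2l // -[leLHS]expr1 ler_weXn2l.
  rewrite sumr_const card_ord -[leLHS]mulr_natr mulrAC ler_pdivrMr // [leRHS]mulrAC -[leRHS]mulrA.
  by rewrite ler_pM2l // ler_pdivlMr ?ltr0n // -natrM ler_nat mulnC t_le.
have tailF : \sum_(i < t) #|Fp i.+1|%:R * #|G|%:R <= f2 / 1000.
  apply: (tail (fun i => #|Fp i|%:R * #|G|%:R)) => i /andP[i1 it].
  have FpF s : s \in Fp i -> s \in F by rewrite inE => /andP[].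
  apply: (product_small i1 it _ mB) => [s u /FpF|s]; first exact: FG.
  by rewrite inE => /andP[_ /eqP si]; rewrite -si subKn // ltnW // -subn_gt0 si.
have tailG : \sum_(i < t) #|Gp i.+1|%:R * #|F|%:R <= f2 / 1000.
  apply: (tail (fun i => #|Gp i|%:R * #|F|%:R)) => i /andP[i1 it].
  have GpG s : s \in Gp i -> s \in G by rewrite inE => /andP[].
  apply: (product_small i1 it _ mA) => [s u /GpG|s]; first exact: GF.
  by rewrite inE => /andP[_ /eqP si]; rewrite -si subKn // ltnW // -subn_gt0 si.
have FR := sumE F B; have GR := sumE G A.
rewrite big_ord_recl -/(Fp 0%N) in FR; rewrite big_ord_recl -/(Gp 0%N) in GR.
have main : 98 / 100 * f2 <= #|Fp 0%N|%:R * #|Gp 0%N|%:R.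
  have big : 99 * f2 <= 100 * (#|F|%:R * #|G|%:R) by rewrite /f2 -natrX -!natrM ler_nat.
  rewrite -mulr_suml in tailF; rewrite -mulr_suml in tailG.
  set x := \sum_(i < t) _ in tailF; set y := \sum_(i < t) _ in tailG.
  have {}FR : #|F|%:R = #|Fp 0%N|%:R + x by exact: FR.
  have {}GR : #|G|%:R = #|Gp 0%N|%:R + y by exact: GR.
  have y0 : 0 <= y by apply: sumr_ge0.
  have x0 : 0 <= x by apply: sumr_ge0.
  have h : #|Fp 0%N|%:R * y <= y * #|F|%:R by rewrite mulrC ler_wpM2l // FR lerDl.
  have e : #|F|%:R * #|G|%:R = #|Fp 0%N|%:R * #|Gp 0%N|%:R + #|Fp 0%N|%:R * y + x * #|G|%:R.
    by rewrite [in LHS]FR mulrDl [in X in X + _]GR mulrDr.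
  exact: main_arith f20 big e h tailF tailG.
have Fp0 : (0 < #|Fp 0%N|)%N.
  rewrite lt0n; apply: contraTneq main => ->; rewrite mul0r -ltNge.
  by rewrite mulr_gt0 // divr_gt0 // ltr0n.
have Gp0 : (0 < #|Gp 0%N|)%N.
  rewrite lt0n; apply: contraTneq main => ->; rewrite mulr0 -ltNge.
  by rewrite mulr_gt0 // divr_gt0 // ltr0n.
have FpB s : s \in Fp 0%N -> (t - 0 <= #|gr s :&: B|)%N by rewrite inE subn0 subn_eq0 => /andP[].
have GpA s : s \in Gp 0%N -> (t - 0 <= #|gr s :&: A|)%N by rewrite inE subn0 subn_eq0 => /andP[].
have FpF : Fp 0%N \subset F by apply/subsetP => s; rewrite inE => /andP[].
have GpG : Gp 0%N \subset G by apply/subsetP => s; rewrite inE => /andP[].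
have := product_cover mA mB A6 B6 FpF GpG Fp0 Gp0 (leq0n t) (leq0n t) FpB GpA.
have tB : (t <= #|B|)%N.
  have /card_gt0P[s /FpB sB] := Fp0; rewrite subn0 in sB.
  by apply: leq_trans sB _; rewrite subset_leq_card ?subsetIr.
have tA : (t <= #|A|)%N.
  have /card_gt0P[s /GpA sA] := Gp0; rewrite subn0 in sA.
  by apply: leq_trans sA _; rewrite subset_leq_card ?subsetIr.
rewrite expr0 mulr1 subn0 -/f2 -mulrA.
move=> /(le_trans main); rewrite mulrC ler_pM2l // => h.
have dA0 := dens_ge0 R A F; have dA1 := dens_le1 R A F.
have dB0 := dens_ge0 R B G; have dB1 := dens_le1 R B G.
(* A single point beyond [t] in [A] or [B] would cost a factor 10, but the product is at least
   0.98. *)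
have w0 : (#|A| - t + (#|B| - t) = 0)%N.
  apply/eqP; rewrite -leqn0 leqNgt; apply/negP => w1.
  have t10 : 10 <= 10 ^+ (#|A| - t + (#|B| - t)) :> R.
    by rewrite -[leLHS]expr1 ler_weXn2l // ler1n.
  have : dens R A F / 10 ^+ (#|A| - t + (#|B| - t)) <= 1 / 10.
    apply: ler_pM => //; first by rewrite invr_ge0 exprn_ge0 // ler0n.
    by rewrite lef_pV2 ?posrE ?exprn_gt0 ?ltr0n.
  have e0 : 0 <= dens R A F / 10 ^+ (#|A| - t + (#|B| - t)).
    by rewrite divr_ge0 ?exprn_ge0 ?ler0n.
  move: (dens R A F / _) e0 h => e e0 h; have := ler_wpM2l e0 dB1; lra.
rewrite w0 expr0 divr1 in h.
have [hA hB] := two_densities_arith dA0 dA1 dB0 dB1 h.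
have At : #|A| = t.
  by apply/eqP; rewrite eqn_leq tA andbT -subn_eq0 -leqn0 -[leqRHS]w0 leq_addr.
have Bt : #|B| = t.
  by apply/eqP; rewrite eqn_leq tB andbT -subn_eq0 -leqn0 -[leqRHS]w0 leq_addl.
have ABt : (t <= #|A :&: B|)%N.
  rewrite leqNgt; apply/negP => ABt.
  apply: (max_sets_far bF bG FG mA mB ABt) => d /(pow54_small hA) d3.
  by rewrite cardsD (cardsD B A) [B :&: A]setIC At Bt far_arith.
have AB1 : A :&: B = A by apply/eqP; rewrite eqEcard subsetIl At.
have AB2 : A :&: B = B by apply/eqP; rewrite eqEcard subsetIr Bt.
exists A; split=> //.
by rewrite -AB1 AB2.
Qed.

(** A larger [F] would have a fine maximal set not containing [T], hence sharing fewer than [t]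
    points with it, and [exact_agreement] would produce the forbidden number of agreements. *)
Lemma outside_small F G T :
  (forall s u, s \in F -> u \in G -> #|gr s :&: gr u| <> (t - 1)%N) ->
  #|T| = t -> 98 / 100 <= dens R T G -> (forall s, s \in F -> ~~ (T \subset gr s)) ->
  (n ^ (2 * t) * #|F| < (n - t)`!)%N.
Proof.
move=> FG Tt dG FT; rewrite ltnNge; apply/negP => big.
have tn : (t <= n)%N by apply: leq_trans t_le; rewrite leq_pmull.
have nf : (n`! <= n ^ t * (n - t)`!)%N by have := fact_sub_le (leqnn t) tn; rewrite subnn subn0.
have nt0 : 0 < n%:R ^- (3 * t) :> R by rewrite invr_gt0 exprn_gt0.
have [A mA] := exists_max r set0 F; have [_ /(_ set0 (subxx _)) pA] := mA.
have {}pA : n%:R ^- (3 * t) <= pot r A F.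
  apply: le_trans pA.
  rewrite /pot dens_set0 cards0 expr0 divr1 ler_pdivlMr ?fact_gt0R // ler_pdivrMl ?exprn_gt0 //.
  rewrite -natrX -natrM ler_nat (leq_trans nf) // mulSn expnD -mulnA leq_mul2l.
  by rewrite big orbT.
have gF := max_glob mA; rewrite -(pot_famE r F (subxx A)) in pA.
have gG : glob r T (fam G T).
  split=> [u /mem_fam[]//|D TD]; rewrite !pot_famE //.
  have [->|TnD] := eqVneq T D; first by [].
  have tD : (t < #|D|)%N by rewrite -Tt proper_card // properEneq TnD.
  apply: (@le_trans _ _ (r ^- t.+1)).
    apply: le_trans (_ : r ^- #|D| <= _).
      rewrite /pot ler_pdivrMr ?exprn_gt0 // mulVf ?dens_le1 //.
      by rewrite expf_neq0 // gt_eqF.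
    by rewrite lef_pV2 ?posrE ?exprn_gt0 // ler_weXn2l // ltW.
  rewrite /pot Tt exprS invfM ler_pM2r ?invr_gt0 ?exprn_gt0 //.
  by apply: le_trans dG; rewrite /r invf_div; lra.
have pT : n%:R ^- (3 * t) <= 2 * pot r T (fam G T).
  rewrite pot_famE // /pot Tt; apply: (@le_trans _ _ (r ^- t)).
    rewrite lef_pV2 ?posrE ?exprn_gt0 //; apply: (@le_trans _ _ (n%:R ^+ t)).
      apply: lerXn2r; rewrite ?nnegrE ?(ltW r0) ?(ltW n0) //.
      by rewrite /r ler_pdivrMr ?ltr0n // -natrM ler_nat (leq_trans _ (leq_mul n2000 (leqnn 4))).
    by rewrite ler_weXn2l // leq_pmull.
  rewrite mulrA ler_peMl ?invr_ge0 ?exprn_ge0 ?(ltW r0) //.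
  lra.
have AT : (#|A :&: T| < t)%N.
  have [s sF As] := pot_gt0 r0 (lt_le_trans nt0 pA).
  have {sF}sF : s \in F by have [] := mem_fam sF.
  rewrite -Tt proper_card // properEneq subsetIr andbT.
  apply: contra (FT s sF) => /eqP <-.
  by apply: subset_trans As; rewrite subsetIl.
pose k := (t - 1 - #|A :&: T|)%N.
have kE : (#|A :&: T| + k = t - 1)%N by rewrite subnKC // -ltnS subn1 prednK.
have kt : (k <= t)%N by rewrite (leq_trans (leq_subr _ _)) ?leq_subr.
have [||s [u [sF1 uG1 su]]] := exact_agreement n2000 nM gF gG
  (pot_enough kt _) (pot_enough kt _).
- apply: le_trans pA _; rewrite ler_peMl ?pot_ge0 ?(ltW r0) // ler1n //.
- exact: pT.
apply: (FG s u); last by rewrite su kE.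
  by have /mem_fam[] := sF1.
by have /mem_fam[] := uG1.
Qed.

End Scale.

(** * Permutations with a prescribed number of agreements with a fixed one *)

(** The numbers [z], [a], [b] count permutations with no, one, and at least two agreements in the
    rows considered. *)
Lemma derange_arith (f z a b : nat) : (2 * b <= f)%N -> (a <= 2 * z)%N ->
  (f <= z + a + b)%N -> (f <= 6 * z)%N.
Proof. lia. Qed.

Lemma fact_predE (m : nat) : (0 < m)%N -> (m * m.-1`! = m`!)%N.
Proof. by case: m => // m _; rewrite factS. Qed.

Lemma ffact_lower (a b k : nat) : (a + k <= b)%N -> (a ^ k <= b ^_ k)%N.
Proof.
elim: k => // k IHk h; rewrite expnSr ffactnSr leq_mul //.
  by apply: IHk; apply: leq_trans h; rewrite leq_add2l.
by clear IHk; lia.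
Qed.

(** Since [n <= 2 * (n - 3 * t)], the power [n ^ k] is at most [2 ^ k * k! * 'C(a, k)]; bounding
    [2 ^ k * k!] by [(2 * t) ^ t] gives the shape of the deficit. *)
Lemma draws_lower (n t k a : nat) : (6 * t <= n)%N -> (k < t)%N -> (n - 2 * t <= a)%N ->
  ((n - t)`! <= (2 * t) ^ t * ('C(a, k) * (n - (t + k))`!))%N.
Proof.
move=> tn kt ta.
have kt' := ltnW kt; have t0 : (0 < t)%N by apply: leq_ltn_trans kt.
have h1 : ((n - t)`! <= n ^ k * (n - (t + k))`!)%N.
  have -> : (n - t = n - (t + k - k))%N by rewrite addnK.
  by apply: fact_sub_le; [rewrite leq_addl|lia].
have h2 : (n ^ k <= 2 ^ k * (k`! * 'C(a, k)))%N.
  rewrite mulnC [(k`! * _)%N]mulnC bin_ffact mulnC.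
  apply: leq_trans (_ : (2 * (n - 3 * t)) ^ k <= _)%N.
    by case: (k) => // k'; rewrite leq_exp2r //; lia.
  by rewrite expnMn leq_mul2l ffact_lower ?orbT //; lia.
have h3 : (2 ^ k * k`! <= (2 * t) ^ t)%N.
  rewrite expnMn leq_mul ?leq_pexp2l //; apply: leq_trans (_ : t ^ k <= _)%N.
    elim: {h1 h2 kt ta}k kt' => // k IHk kt; rewrite factS expnS leq_mul // IHk // ltnW //.
  by rewrite leq_pexp2l.
apply: leq_trans h1 _; rewrite mulnA leq_mul2r; apply/orP; right.
by apply: leq_trans h2 _; rewrite mulnA leq_mul2r h3 orbT.
Qed.

Section NearDerangements.
Context (n : nat).
Implicit Types (s u v : {perm 'I_n}) (S T : {set 'I_n * 'I_n}).

Definition off_rows s S : {set 'I_n * 'I_n} := restr s (~: (fst @: S)).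

Lemma mem_restr s (I : {set 'I_n}) i j : ((i, j) \in restr s I) = (i \in I) && (j == s i).
Proof.
apply/imsetP/andP => [[k kI [-> ->]]|[iI /eqP ->]]; first by rewrite kI eqxx.
by exists i.
Qed.

Lemma swap_mem S u i i' : S \subset gr u -> i \notin fst @: S -> i' \notin fst @: S ->
  S \subset gr (tperm i i' * u)%g.
Proof.
move=> /subsetP Su iS i'S; apply/subsetP => -[a b] ab.
have aS : a \in fst @: S by apply/imsetP; exists (a, b).
rewrite mem_gr permM tpermD; first by rewrite -mem_gr Su.
  by apply: contraNneq iS => ->.
by apply: contraNneq i'S => ->.
Qed.

(** Exchanging row [i] with any other free row [i'] destroys the only agreement and creates none.
    The row [i'] can be read off the result, as the one sent to [s i], so the images for different
    [i'] are disjoint. *)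
Lemma single_hit_card S s i : i \notin fst @: S ->
  (#|[set u in fam setT S | (s i == u i) && [forall (j | j \notin i |: (fst @: S)), s j != u j]]|
     * (n - #|fst @: S|).-1 <= #|few_hits (fam setT S) (off_rows s S) 0|)%N.
Proof.
move=> iS; set N := [set u in _ | _]; set Z := few_hits _ _ _.
have step i' : i' \in ~: (i |: (fst @: S)) -> (#|N| <= #|[set v in Z | v i' == s i]|)%N.
  rewrite !inE negb_or => /andP[ii' i'S].
  rewrite -(card_imset _ (mulgI (tperm i i'))); apply: subset_leq_card.
  apply/subsetP => _ /imsetP[u uN ->]; move: uN; rewrite inE => /andP[/mem_fam[_ Su]].
  case/andP => /eqP si /forall_inP su; rewrite inE permM tpermR -si eqxx andbT.
  rewrite !inE swap_mem //= leqn0 cards_eq0 -subset0; apply/subsetP => -[a b] /setIP[].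
  rewrite mem_gr mem_restr => /eqP ab /andP[aS /eqP bs]; exfalso.
  rewrite inE in aS; rewrite permM in ab.
  have [ai|ai] := eqVneq a i.
    move: ab; rewrite ai tpermL => ab; move: bs; rewrite ai si -ab => /perm_inj e.
    by rewrite e eqxx in ii'.
  have [ai'|ai'] := eqVneq a i'.
    move: ab; rewrite ai' tpermR -si => ab; move: bs; rewrite ai' -ab => /perm_inj e.
    by rewrite e eqxx in ii'.
  have := su a; rewrite !inE negb_or ai aS => /(_ isT).
  by rewrite -bs -ab tpermD ?eqxx // eq_sym.
have cardI : #|~: (i |: (fst @: S))| = (n - #|fst @: S|).-1.
  by rewrite cardsCs setCK card_ord cardsU1 iS add1n subnS.
rewrite -cardI mulnC -sum_nat_const.
apply: (@leq_trans (\sum_(i' in ~: (i |: (fst @: S))) #|[set v in Z | v i' == s i]|)%N).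
  by apply: leq_sum => i'; apply: step.
apply: leq_trans (_ : \sum_i' #|[set v in Z | v i' == s i]| <= _)%N.
  by rewrite [leqRHS](bigID (mem (~: (i |: (fst @: S))))) leq_addr.
rewrite -[leqRHS]sum1_card (partition_big (fun v : {perm 'I_n} => (v^-1)%g (s i)) xpredT) //=.
apply: leq_sum => i' _; rewrite -sum1_card; apply: eq_leq; apply: eq_bigl => v.
rewrite inE; congr (_ && _); apply/eqP/eqP => [<-|<-]; first by rewrite permK.
by rewrite permKV.
Qed.

(* By Markov's inequality at least half of the permutations above [S] have at most
   one agreement with [s] off [S], and [single_hit_card] removes that agreement by
   a transposition. *)
Lemma off_rows_derangements S s u0 : S \subset gr u0 -> (#|S|.+2 <= n)%N ->
  ((n - #|S|)`! <= 6 * #|few_hits (fam setT S) (off_rows s S) 0|)%N.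
Proof.
move=> Su0 Sn; have dS := card_dom Su0; set m := (n - #|S|)%N.
have m2 : (2 <= m)%N by rewrite leq_subRL ?addn2 // (leq_trans _ Sn) // -addn2 leq_addr.
set D := off_rows s S; set FS := fam setT S; set Z := few_hits FS D 0.
have cD : #|D| = m by rewrite card_restr cardsCs setCK card_ord dS.
have FSc : #|FS| = m`! by rewrite (card_famT Su0).
pose N i := [set u in FS | (s i == u i) && [forall (j | j \notin i |: (fst @: S)), s j != u j]].
have two : (2 * #|[set u in FS | (2 <= #|gr u :&: D|)%N]| <= m`!)%N.
  apply: leq_trans (card_hits FS D 2) _.
  apply: leq_trans (_ : \sum_(y in D) m.-1`! <= _)%N.
    apply: leq_sum => -[i j]; rewrite mem_restr inE => /andP[iS _].
    rewrite famU (leq_trans (card_fam_le _ _)) //.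
    have ijS : (i, j) \notin S by apply: contra iS => /(imset_f fst).
    by rewrite setUC cardsU1 ijS add1n subnS.
  by rewrite sum_nat_const cD fact_predE // ltnW.
have one : (#|[set u in FS | #|gr u :&: D| == 1%N]| <= \sum_(i in ~: (fst @: S)) #|N i|)%N.
  have subN : [set u in FS | #|gr u :&: D| == 1%N] \subset \bigcup_(i in ~: (fst @: S)) N i.
    apply/subsetP => u; rewrite inE => /andP[uF /cards1P[[a b] uD]].
    have : (a, b) \in gr u :&: D by rewrite uD inE.
    case/setIP; rewrite mem_gr mem_restr => /eqP ua /andP[aS /eqP ba].
    apply/bigcupP; exists a => //; rewrite inE uF -ba ua eqxx /=.
    apply/forall_inP => j; rewrite !inE negb_or => /andP[ja jS].
    apply: contra ja => /eqP sj.
    have : (j, s j) \in gr u :&: D by rewrite inE mem_gr mem_restr inE jS sj !eqxx.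
    by rewrite uD inE => /eqP [->].
  apply: leq_trans (subset_leq_card subN) _.
  elim/big_rec2: _ => [|i a U _ IH]; first by rewrite cards0.
  by rewrite (leq_trans (leq_card_setU _ _)) // leq_add2l.
have oneZ : (#|[set u in FS | #|gr u :&: D| == 1%N]| <= 2 * #|Z|)%N.
  have m1 : (0 < m.-1)%N by rewrite -ltnS (ltn_predK m2).
  rewrite -(leq_pmul2r m1) (leq_trans (leq_mul one (leqnn _))) // big_distrl /=.
  apply: leq_trans (_ : \sum_(i in ~: (fst @: S)) #|Z| <= _)%N.
    by apply: leq_sum => i; rewrite inE => iS; rewrite /m -dS single_hit_card.
  rewrite sum_nat_const cardsCs setCK card_ord dS -/m mulnAC leq_mul2r.
  by apply/orP; right; rewrite mul2n -addnn -{1}(ltn_predK m2) -addn1 leq_add2l.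
have : (m`! <= #|Z| + #|[set u in FS | #|gr u :&: D| == 1%N]| +
    #|[set u in FS | (2 <= #|gr u :&: D|)%N]|)%N.
  rewrite -FSc; apply: leq_trans (subset_leq_card (_ : FS \subset
    (Z :|: [set u in FS | #|gr u :&: D| == 1%N]) :|: [set u in FS | (2 <= #|gr u :&: D|)%N])) _.
    apply/subsetP => u uF; apply/setUP; case E : #|gr u :&: D| => [|[|h]].
    - by left; apply/setUP; left; rewrite inE uF E.
    - by left; apply/setUP; right; rewrite inE uF E.
    - by right; rewrite inE uF E.
  rewrite (leq_trans (leq_card_setU _ _)) // leq_add2r.
  exact: leq_card_setU.
exact: derange_arith.
Qed.

(** Points of [s] are imposed one row at a time: a transposition with the row currently sent to the
    wanted column does it, and both rows are free. This certifies the union as a partial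
    permutation. *)
Lemma gr_extend S u0 (C : {set 'I_n}) s : S \subset gr u0 -> [disjoint C & fst @: S] ->
  [disjoint s @: C & snd @: S] -> exists u, S :|: restr s C \subset gr u.
Proof.
move=> Su0; elim: {C}_.+1 {-2}C (ltnSn #|C|) => // k IHk C Ck CS sCS.
have [->|[i iC]] := set_0Vmem C.
  by exists u0; rewrite subUset Su0; apply/subsetP => y /imsetP[j]; rewrite inE.
have Ci : C :\ i \subset C by rewrite subsetDl.
have [|||u Su] := IHk (C :\ i).
- by rewrite (cardsD1 i C) iC in Ck.
- by apply: disjointWl CS.
- by apply: disjointWl sCS; apply: imsetS.
set S' := S :|: restr s (C :\ i) in Su.
pose j := (u^-1)%g (s i).
have iS' : i \notin fst @: S'.
  apply/imsetP => -[[a b] /setUP[abS|abC] /= ia].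
    have := disjointFr CS iC; rewrite ia => /imsetP[]; by exists (a, b).
  by move: abC; rewrite mem_restr -ia !inE eqxx.
have jS' : j \notin fst @: S'.
  apply/imsetP => -[[a b] ab /= ja].
  have := subsetP Su _ ab; rewrite mem_gr -ja /j permKV => /eqP sib.
  case/setUP: ab => [abS|].
    have := disjointFr sCS (imset_f s iC); rewrite sib => /imsetP[]; by exists (a, b).
  rewrite mem_restr -sib => /andP[aC /eqP /perm_inj ai].
  by rewrite -ai !inE eqxx in aC.
exists (tperm i j * u)%g.
have := swap_mem Su iS' jS'; rewrite /S' !subUset => /andP[-> /subsetP sub] /=.
apply/subsetP => -[a b]; rewrite mem_restr => /andP[aC /eqP ->].
have [->|ai] := eqVneq a i; first by rewrite mem_gr permM tpermL /j permKV.
by apply: sub; rewrite mem_restr !inE ai aC eqxx.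
Qed.


(** The [k] agreements missing from t - 1 are prescribed on a set [C] of free rows, and agreement is
    forbidden elsewhere off [T]. Different [C] give disjoint classes, each a sixth of all
    permutations through the prescribed points, by [off_rows_derangements]. *)
Lemma exact_agreement_count T s u0 (t : nat) : T \subset gr u0 -> #|T| = t ->
  ~~ (T \subset gr s) -> (6 * t <= n)%N ->
  ((n - t)`! <= 6 * ((2 * t) ^ t *
     #|[set u in fam setT T | #|gr s :&: gr u| == (t - 1)%N]|))%N.
Proof.
move=> Tu0 Tt Ts tn; set Bad := [set u in _ | _].
have dT := card_dom Tu0; have cT := card_codom Tu0.
have at1 : (#|gr s :&: T| < t)%N.
  rewrite -Tt proper_card // properEneq subsetIr andbT.
  by apply: contra Ts => /eqP <-; rewrite subsetIl.
have t0 : (0 < t)%N by apply: leq_ltn_trans at1.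
set k := (t - 1 - #|gr s :&: T|)%N.
have ak : (#|gr s :&: T| + k = t - 1)%N by rewrite subnKC // -ltnS subn1 prednK.
have kt : (k < t)%N by rewrite (leq_ltn_trans (leq_subr _ _)) // subn1 ltn_predL.
(* Rows where agreement with [s] is compatible with [T]: neither the row nor its column under [s] is
   used. *)
pose U := [set i | (i \notin fst @: T) && (s i \notin snd @: T)].
have Uc : (n - 2 * t <= #|U|)%N.
  rewrite leq_subLR -[leqLHS](card_ord n) -(cardsC U) addnC leq_add2r.
  apply: (@leq_trans #|(fst @: T) :|: (s @^-1: (snd @: T))|).
    by apply: subset_leq_card; apply/subsetP => i; rewrite !inE negb_and !negbK.
  apply: leq_trans (leq_card_setU _ _) _.
  by rewrite (card_preimset _ perm_inj) mul2n -addnn dT cT Tt.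
have sub (C : {set 'I_n}) : C \subset U -> #|C| = k ->
    ((n - (t + k))`! <= 6 * #|[set u in Bad | [set i in U | u i == s i] == C]|)%N.
  move=> CU Ck; pose S := T :|: restr s C.
  have CT : [disjoint C & fst @: T].
    by rewrite disjoints_subset; apply/subsetP => i /(subsetP CU); rewrite !inE => /andP[].
  have sCT : [disjoint s @: C & snd @: T].
    rewrite disjoints_subset; apply/subsetP => _ /imsetP[i /(subsetP CU) + ->].
    by rewrite !inE => /andP[].
  have [u1 Su1] := gr_extend Tu0 CT sCT.
  have dS : fst @: S = (fst @: T) :|: C.
    rewrite imsetU; congr (_ :|: _); rewrite -imset_comp -[RHS]imset_id.
    by apply: eq_imset.
  have Sc : #|S| = (t + k)%N.
    by rewrite -(card_dom Su1) -/S dS cardsU disjoint_setI0 1?disjoint_sym // cards0 subn0 dT Tt Ck.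
  have Sn : (#|S|.+2 <= n)%N by rewrite Sc; lia.
  have := off_rows_derangements s Su1 Sn; rewrite -/S Sc => /leq_trans; apply.
  rewrite leq_mul2l /=; apply: subset_leq_card; apply/subsetP => u.
  rewrite inE leqn0 cards_eq0 => /andP[/mem_fam[_ Su] /eqP noh].
  have off i : i \notin fst @: T -> i \notin C -> u i != s i.
    move=> iT iC; apply: contraTneq isT => ui.
    have : (i, s i) \in gr u :&: off_rows s S.
      by rewrite inE mem_gr mem_restr ui dS in_setC in_setU negb_or iT iC !eqxx.
    by rewrite noh inE.
  have [Tu Cu] : T \subset gr u /\ restr s C \subset gr u.
    by move: Su; rewrite subUset => /andP[].
  have onC i : i \in C -> u i = s i.
    by move=> iC; apply/eqP; rewrite -mem_gr (subsetP Cu) // mem_restr iC eqxx.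
  have idx : [set i in U | u i == s i] = C.
    apply/setP => i; rewrite inE; apply/andP/idP => [[iU ui]|iC].
      apply: contraTT ui => iC; apply: off => //.
      by move: iU; rewrite inE => /andP[].
    by rewrite (subsetP CU) ?onC.
  have agr : gr s :&: gr u = (gr s :&: T) :|: restr s C.
    apply/setP => -[i j]; rewrite in_setI in_setU [in RHS]in_setI !mem_gr mem_restr.
    apply/andP/orP => [[/eqP si /eqP ui]|[/andP[/eqP si ijT]|/andP[iC /eqP ->]]].
    - rewrite si eqxx /=; case: (boolP (i \in C)) => iC; first by right.
      left; case: (boolP (i \in fst @: T)) => [/imsetP[[a b] abT /= ia]|iT].
        have := subsetP Tu _ abT; rewrite mem_gr -ia ui => /eqP jb.
        by rewrite ia jb -ia in abT *.
      by have := off i iT iC; rewrite ui si eqxx.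
    - by rewrite si eqxx -mem_gr (subsetP Tu).
    - by rewrite onC.
  have dj : [disjoint gr s :&: T & restr s C].
    rewrite -setI_eq0; apply/eqP/setP => -[i j]; rewrite !inE mem_restr; apply/negbTE.
    apply/negP => /andP[/andP[_ ijT] /andP[iC _]].
    by have := disjointFr CT iC => /imsetP[]; exists (i, j).
  rewrite !inE Tu idx eqxx /= andbT agr cardsU (disjoint_setI0 dj) cards0 subn0.
  by rewrite card_restr Ck ak.
have BadE : (\sum_(C : {set 'I_n} | (C \subset U) && (#|C| == k))
    #|[set u in Bad | [set i in U | u i == s i] == C]| <= #|Bad|)%N.
  rewrite -[leqRHS]sum1_card (partition_big (fun u : {perm 'I_n} => [set i in U | u i == s i]) xpredT) //=.
  rewrite [leqRHS](bigID (fun C : {set 'I_n} => (C \subset U) && (#|C| == k))) /=.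
  apply: leq_trans (leq_addr _ _); apply: leq_sum => C _.
  by rewrite -sum1_card; apply: eq_leq; apply: eq_bigl => u; rewrite inE.
apply: leq_trans (draws_lower tn kt Uc) _.
rewrite [leqRHS]mulnCA leq_mul2l; apply/orP; right.
apply: leq_trans (leq_mul (leqnn 6) BadE).
rewrite -cards_draws -sum_nat_const big_distrr /=.
rewrite [leqRHS](eq_bigl (mem [set C : {set 'I_n} | C \subset U & #|C| == k])); last first.
  by move=> C; rewrite !inE.
by apply: leq_sum => C; rewrite inE => /andP[CU /eqP Ck]; apply: sub.
Qed.

End NearDerangements.

(** * Conclusion *)

Lemma sq_le_pow2 (k : nat) : ((30 + k) * (30 + k) <= 2 ^ (11 + k))%N.
Proof.
elim: k => [|k IHk]; first by [].
rewrite addnS [(11 + k.+1)%N]addnS expnS; apply: leq_trans (leq_mul (leqnn 2) IHk).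
by move: (k) => m; nia.
Qed.

(** The inequality [(1 + e) * (1 - 7 * e) <= 1 - e]: the loss [B] of [8 * e] outweighs both gains of
    [e]. *)
Lemma product_deficit_arith (R : realFieldType) (f a b fo gT go B e : R) :
  0 < f -> 0 < e -> a <= f + fo -> fo <= e * f -> b = gT + go -> go <= e * f ->
  gT + B <= f -> 8 * e * f <= B -> 0 <= a -> 0 <= b -> a * b <= (1 - e) * f ^+ 2.
Proof.
move=> f0 e0 ha hfo hb hgo hgT hB a0 b0.
have h1 : a <= (1 + e) * f by lra.
have h2 : b <= (1 - 7 * e) * f by lra.
apply: le_trans (ler_pM a0 b0 h1 h2) _.
have -> : (1 + e) * f * ((1 - 7 * e) * f) = (1 - 6 * e - 7 * e ^+ 2) * f ^+ 2 by ring.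
rewrite ler_pM2r ?exprn_gt0 //; have := sqr_ge0 e; lra.
Qed.

Lemma hundredth_arith (R : realFieldType) (e f p : R) : e <= 1 / 100 -> 0 <= f ->
  (1 - e) * f < p -> 99 * f <= 100 * p.
Proof. by move=> he f0 big; have := ler_wpM2r f0 he; lra. Qed.

(** * No permutation lies outside the core *)

Section Containment.
Context (R : realType) (n t M X : nat).
Implicit Types (s u : {perm 'I_n}) (F G : {set {perm 'I_n}}).
Hypotheses (n2000 : (2000 <= n)%N) (nM : (1000 * M <= n)%N) (t1 : (1 <= t)%N).
Hypotheses (X3 : (3 <= X)%N) (tX : (1000 * (t * X) <= n)%N).
Hypotheses (hM : n%:R ^+ (12 * t) <= (5 / 4) ^+ M :> R).

Lemma subset_core F G (T : {set 'I_n * 'I_n}) :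
  (forall s u, s \in F -> u \in G -> #|gr s :&: gr u| <> (t - 1)%N) ->
  #|T| = t -> 98 / 100 <= dens R T F -> 98 / 100 <= dens R T G ->
  (1 - 1 / (100 * t%:R) ^+ t) * ((n - t)`!%:R ^+ 2) < #|F|%:R * #|G|%:R :> R ->
  forall s, s \in F -> T \subset gr s.
Proof.
move=> FG Tt dF dG big s0 s0F; apply: contraLR big => Ts0; rewrite -leNgt.
have t1000 : (1000 * t <= n)%N.
  by apply: leq_trans tX; rewrite leq_mul2l /= leq_pmulr // (leq_trans _ X3).
have [u0 u0G Tu0] : exists2 u, u \in G & T \subset gr u.
  by apply: (@dens_gt0 R); apply: lt_le_trans dG; rewrite divr_gt0 ?ltr0n.
have t6 : (6 * t <= n)%N by apply: leq_trans t1000; rewrite leq_mul2r orbT.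
have cnt := exact_agreement_count Tu0 Tt Ts0 t6.
set Bad := [set u in _ | _] in cnt.
have GF u s : u \in G -> s \in F -> #|gr u :&: gr s| <> (t - 1)%N.
  by move=> uG sF; rewrite setIC; apply: FG.
have outF : (n ^ (2 * t) * #|F :\: fam F T| < (n - t)`!)%N.
  apply: (outside_small n2000 nM t1 X3 tX hM (F := F :\: fam F T) (G := G) _ Tt dG) => [s u|s].
    by case/setDP => sF _; apply: FG.
  by case/setDP => sF; rewrite inE sF.
have outG : (n ^ (2 * t) * #|G :\: fam G T| < (n - t)`!)%N.
  apply: (outside_small n2000 nM t1 X3 tX hM (F := G :\: fam G T) (G := F) _ Tt dF) => [s u|s].
    by case/setDP => sF _; apply: GF.
  by case/setDP => sF; rewrite inE sF.
have GB : (#|fam G T| + #|Bad| <= (n - t)`!)%N.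
  rewrite -Tt -(card_famT Tu0).
  have dj : [disjoint fam G T & Bad].
    rewrite -setI_eq0 -subset0; apply/subsetP => u /setIP[/mem_fam[uG _]].
    by rewrite inE => /andP[_ /eqP]; move/(FG _ _ s0F uG).
  have := cardsUI (fam G T) Bad; rewrite (disjoint_setI0 dj) cards0 addn0 => <-.
  by apply: subset_leq_card; rewrite subUset famS ?subsetT //; apply/subsetP => u; rewrite inE => /andP[].
have f0 := fact_gt0R R (n - t).
set f : R := (n - t)`!%:R in f0 *.
have tR : 1 <= t%:R :> R by rewrite ler1n.
set E : R := (100 * t%:R) ^+ t.
have E0 : 0 < E by rewrite exprn_gt0 // mulr_gt0 ?ltr0n.
have EN : E = (50 ^ t * (2 * t) ^ t)%N%:R by rewrite -expnMn mulnA natrX natrM.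
have e0 : 0 < 1 / E by rewrite divr_gt0.
(* This needs [(100 * t) ^ t <= n ^ (2 * t)], true as [n >= 100] and [n >= t]. *)
have out (x : nat) : (n ^ (2 * t) * x < (n - t)`!)%N -> x%:R <= 1 / E * f.
  move=> hx; rewrite mulrAC mul1r ler_pdivlMr //.
  apply: le_trans (_ : (n ^ (2 * t) * x)%N%:R <= _); last by rewrite ler_nat ltnW.
  rewrite mulrC natrM ler_wpM2r // natrX exprM; apply: lerXn2r.
  - by rewrite nnegrE mulr_ge0.
  - by rewrite nnegrE exprn_ge0.
  rewrite -natrX -natrM ler_nat expnS expn1 leq_mul //.
    by apply: leq_trans n2000.
  by apply: leq_trans t1000; rewrite leq_pmull.
(* The count loses [6 * (2 * t) ^ t], and [8 * 6 <= 50 ^ t] accounts for the 100 in the deficit. *)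
have bad8 : 8 * (1 / E) * f <= #|Bad|%:R.
  have h50 : (8 * 6 <= 50 ^ t)%N.
    by apply: leq_trans (_ : 50 ^ 1 <= _)%N; rewrite // leq_pexp2l.
  have key : (8 * (n - t)`! <= #|Bad| * (50 ^ t * (2 * t) ^ t))%N.
    apply: leq_trans (leq_mul (leqnn 8) cnt) _.
    by rewrite mulnA [((2 * t) ^ t * _)%N]mulnC mulnCA leq_mul2l leq_mul2r h50 !orbT.
  have -> : 8 * (1 / E) * f = 8 * f / E by rewrite mul1r mulrAC.
  by rewrite ler_pdivrMr // EN -(natrM _ 8) -natrM ler_nat.
have cF : #|F|%:R <= f + #|F :\: fam F T|%:R.
  rewrite -natrD ler_nat -(cardsID (fam F T) F) (setIidPr (fam_sub F T)) leq_add2r.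
  by rewrite -Tt card_fam_le.
have cG : #|G|%:R = #|fam G T|%:R + #|G :\: fam G T|%:R :> R.
  by rewrite -natrD -(cardsID (fam G T) G) (setIidPr (fam_sub G T)).
have GBR : #|fam G T|%:R + #|Bad|%:R <= f by rewrite -natrD ler_nat.
exact: (product_deficit_arith f0 e0 cF (out _ outF) cG (out _ outG) GBR bad8).
Qed.

End Containment.

Lemma pinned_of_core (n t : nat) (T : {set 'I_n * 'I_n}) (u0 : {perm 'I_n}) :
  #|T| = t -> T \subset gr u0 ->
  exists i j : 'I_t -> 'I_n, [/\ injective i, injective j &
    forall F : {set {perm 'I_n}}, (forall s, s \in F -> T \subset gr s) -> F \subset pinned_perms i j].
Proof.
move=> Tt /subsetP Tu0; pose p (k : 'I_t) := enum_val (cast_ord (esym Tt) k).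
have pT k : p k \in T by apply: enum_valP.
have p_inj : injective p by move=> k l /enum_val_inj/cast_ord_inj.
have pu k : u0 (p k).1 = (p k).2 by have := Tu0 _ (pT k); rewrite inE => /eqP.
exists (fun k => (p k).1), (fun k => (p k).2); split.
- move=> k l kl; apply: p_inj; move: kl (pu k) (pu l).
  by case: (p k) (p l) => [a b] [c d] /= -> -> ->.
- move=> k l kl; apply: p_inj; move: kl (pu k) (pu l).
  by case: (p k) (p l) => [a b] [c d] /= -> <- /perm_inj ->.
move=> F FT; apply/subsetP => s /FT /subsetP Ts; rewrite inE; apply/forallP => k.
by have := Ts _ (pT k); rewrite inE.
Qed.

(** * Admissible parameters: [X = 24 * l] and [M = n %/ 1000] *)

Section ConcreteScale.
Context (R : realType) (n t l : nat).
Hypotheses (n2 : (2 <= n)%N) (t1 : (1 <= t)%N) (lE : l = up_log 2 n).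
Hypothesis (tl : (2 ^ 38 * (t * l) <= n)%N).

Let l_gt0 : (0 < l)%N. Proof. by rewrite lE up_log_gt0. Qed.

Let n_le : (n <= 2 ^ l)%N. Proof. by rewrite lE up_logP. Qed.

(** Since [t * l >= 1], the hypothesis itself forces [n] to be large; no small cases remain. *)
Lemma log_ge38 : (38 <= l)%N.
Proof.
rewrite -(@leq_exp2l 2) //; apply: leq_trans n_le; apply: leq_trans tl.
by rewrite leq_pmulr // muln_gt0 t1.
Qed.

Lemma scale_n2000 : (2000 <= n)%N.
Proof.
apply: leq_trans tl; apply: leq_trans (_ : 2 ^ 11 * 1 <= _)%N; first by [].
by rewrite leq_mul ?leq_pexp2l // muln_gt0 t1.
Qed.

Lemma scale_tX : (2000 * (t * (24 * l)) <= n)%N.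
Proof.
apply: leq_trans tl; rewrite [(t * _)%N]mulnCA mulnA leq_mul2r; apply/orP; right.
apply: (@leq_trans (2 ^ 11 * 2 ^ 5)); first exact: leq_mul.
by rewrite -expnD leq_pexp2l.
Qed.

Lemma scale_sq : (256 * (24 * l) ^ 2 <= n)%N.
Proof.
have l30 : (30 + (l - 30) = l)%N by rewrite subnKC // (leq_trans _ log_ge38).
have lt : (2 ^ l.-1 < n)%N by rewrite lE up_log_gtn.
apply: leq_trans (ltnW lt); rewrite -(@leq_pmul2l 2) // -expnS prednK //.
have sq := sq_le_pow2 (l - 30); rewrite l30 in sq.
(* The exponent is shared out among the factor 2 * 256, the square of 24 and the square of [l]. *)
have lS : (9 + (10 + (11 + (l - 30))) = l)%N := l30.
rewrite mulnn in sq.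
have a1 : (2 * 256 <= 2 ^ 9)%N by [].
have a2 : (24 ^ 2 <= 2 ^ 10)%N by [].
have := leq_mul a1 (leq_mul a2 sq).
rewrite -(expnD 2 10 (11 + (l - 30))) -(expnD 2 9 (10 + (11 + (l - 30)))) lS.
by rewrite -(expnMn 24 l 2) -(mulnA 2 256).
Qed.

(** The 24 is 4 * 6: four factors 5/4 exceed 2, and [n ^ 6 <= 2 ^ (6 * l)]. *)
Lemma scale_X : n%:R ^+ 6 <= (5 / 4) ^+ (24 * l) :> R.
Proof.
have r4 : 2 <= (5 / 4) ^+ 4 :> R by lra.
have -> : (24 * l = 4 * (l * 6))%N by rewrite (mulnC l) mulnA.
rewrite exprM; apply: le_trans (_ : 2 ^+ (l * 6) <= _).
  rewrite exprM; apply: lerXn2r; rewrite ?nnegrE ?exprn_ge0 ?ler0n //.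
  by rewrite -natrX ler_nat.
by apply: lerXn2r; rewrite ?nnegrE ?exprn_ge0 ?divr_ge0 ?ler0n.
Qed.

Lemma scale_M : n%:R ^+ (12 * t) <= (5 / 4) ^+ (n %/ 1000) :> R.
Proof.
have -> : (12 * t = 6 * (2 * t))%N by rewrite mulnA.
have r1 : 1 <= 5 / 4 :> R by lra.
rewrite exprM; apply: le_trans (_ : ((5 / 4) ^+ (24 * l)) ^+ (2 * t) <= _).
  apply: lerXn2r; rewrite ?nnegrE ?exprn_ge0 ?divr_ge0 ?ler0n //.
  exact: scale_X.
rewrite -exprM ler_weXn2l // leq_divRL //; apply: leq_trans scale_tX.
by rewrite mulnC [(24 * l * _)%N]mulnC -mulnA [leqLHS]mulnA.
Qed.

Lemma scale_q : n%:R <= (n%:R / (16 * (24 * l)%:R)) ^+ 2 :> R.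
Proof.
have n0 : 0 < n%:R :> R by rewrite ltr0n (leq_trans _ n2).
have X0 : 0 < 16 * (24 * l)%:R :> R by rewrite mulr_gt0 ?ltr0n // muln_gt0.
rewrite expr_div_n ler_pdivlMr ?exprn_gt0 // [leRHS]expr2 ler_pM2l //.
rewrite -natrM -natrX ler_nat expnMn.
exact: scale_sq.
Qed.

End ConcreteScale.

Lemma up_log_le_ln (R : realType) (n : nat) : (2 <= n)%N -> (up_log 2 n)%:R <= 4 * ln n%:R :> R.
Proof.
move=> n2; have n0 : 0 < n%:R :> R by rewrite ltr0n (leq_trans _ n2).
have ln2 : 1 / 2 <= ln 2 :> R.
  rewrite -ler_expR lnK ?posrE ?ltr0n //.
  have := expR_ge1Dx (- (1 / 2) : R); rewrite expRN => H.
  have e0 := expR_gt0 (1 / 2 : R).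
  rewrite -[leLHS]invrK -[leRHS]invrK lef_pV2 ?posrE ?invr_gt0 ?ltr0n //.
  by apply: le_trans H; lra.
have h1 : 1 / 2 <= ln n%:R :> R.
  by apply: le_trans ln2 _; rewrite ler_ln ?posrE ?ltr0n ?ler_nat // (leq_trans _ n2).
have h2 : (up_log 2 n).-1%:R * ln 2 <= ln n%:R :> R.
  rewrite mulr_natl -lnXn ?ltr0n // ler_ln ?posrE ?exprn_gt0 ?ltr0n //; last by apply: leq_trans n2.
  by rewrite -natrX ler_nat ltnW // up_log_gtn.
have h3 : (up_log 2 n).-1%:R * (1 / 2) <= (up_log 2 n).-1%:R * ln 2 :> R by rewrite ler_wpM2l.
have -> : (up_log 2 n)%:R = (up_log 2 n).-1%:R + 1 :> R.
  by rewrite natr1 prednK // up_log_gt0.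
lra.
Qed.

Theorem theorem2 (R : realType) :
  exists2 c : R, 0 < c &
    forall (n t : nat) (F G : {set {perm 'I_n}}),
      (2 <= n)%N -> (1 <= t)%N ->
      t%:R <= c * (n%:R / ln n%:R) ->
      (forall s u : {perm 'I_n}, s \in F -> u \in G ->
         #|agreement s u| <> (t - 1)%N) ->
      #|F|%:R * #|G|%:R >
        (1 - 1 / (100 * t%:R) ^+ t) * ((n - t)`!%:R ^+ 2) :> R ->
      exists i j : 'I_t -> 'I_n,
        [/\ injective i, injective j,
            F \subset pinned_perms i j & G \subset pinned_perms i j].
Proof.
(* The factor 4 between [2 ^ 40] and [2 ^ 38] converts the natural logarithm into the rounded binary
   one. *)
exists (2 ^- 40); first by rewrite invr_gt0 exprn_gt0 ?ltr0n.
move=> n t F G n2 t1 tc FG big.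
have {}FG s u : s \in F -> u \in G -> #|gr s :&: gr u| <> (t - 1)%N.
  by move=> sF uG; rewrite -card_agreement; apply: FG.
have GF u s : u \in G -> s \in F -> #|gr u :&: gr s| <> (t - 1)%N.
  by move=> uG sF; rewrite setIC; apply: FG.
pose l := up_log 2 n.
have n0 : 0 < n%:R :> R by rewrite ltr0n (leq_trans _ n2).
have lnn : 0 < ln n%:R :> R by rewrite ln_gt0 // ltr1n.
have tl : (2 ^ 38 * (t * l) <= n)%N.
  have lln := up_log_le_ln R n2; rewrite -/l in lln.
  move: tc; rewrite mulrA ler_pdivlMr // ler_pdivlMl ?exprn_gt0 ?ltr0n // => tc.
  rewrite -(ler_nat R) (natrM _ (2 ^ 38)) (natrM _ t) natrX; apply: le_trans tc.
  rewrite (exprD _ 38 2) -[leRHS]mulrA ler_pM2l ?exprn_gt0 ?ltr0n // [leRHS]mulrCA.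
  apply: ler_wpM2l => //; apply: le_trans lln _.
  by rewrite ler_pM2r // expr2 -natrM ler_nat.
have n2000 := scale_n2000 n2 t1 (erefl l) tl.
have nM : (1000 * (n %/ 1000) <= n)%N by rewrite mulnC leq_trunc_div.
have X3 : (3 <= 24 * l)%N.
  by rewrite (leq_trans (_ : 3 <= 24 * 1)%N) // leq_mul2l /= up_log_gt0 n2.
have tX : (1000 * (t * (24 * l)) <= n)%N.
  by apply: leq_trans (scale_tX tl); rewrite leq_mul2r orbT.
have hX := scale_X R (erefl l).
have hM := scale_M R (erefl l) tl.
have hq := scale_q R n2 t1 (erefl l) tl.
have FGbig : (99 * (n - t)`! ^ 2 <= 100 * (#|F| * #|G|))%N.
  have e100 : 1 / (100 * t%:R) ^+ t <= 1 / 100 :> R.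
    rewrite !mul1r lef_pV2 ?posrE ?exprn_gt0 ?mulr_gt0 ?ltr0n //.
    apply: (@le_trans _ _ ((100 * t%:R) ^+ 1)).
      by rewrite expr1 -natrM ler_nat leq_pmulr.
    by rewrite ler_weXn2l // -natrM ler1n muln_gt0.
  have f0 : 0 <= (n - t)`!%:R ^+ 2 :> R by rewrite exprn_ge0.
  rewrite -(ler_nat R) (natrM _ 99) natrX (natrM _ 100) (natrM _ #|F|).
  exact: hundredth_arith e100 f0 big.
have [T [Tt dF dG]] := exists_core n2000 nM t1 X3 tX hX hM hq FG FGbig.
have [u0 u0F Tu0] : exists2 u, u \in F & T \subset gr u.
  by apply: (@dens_gt0 R); apply: lt_le_trans dF; rewrite divr_gt0 ?ltr0n.
have [i [j [ii jj pin]]] := pinned_of_core Tt Tu0.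
exists i, j; split=> //; apply: pin.
  exact: (subset_core n2000 nM t1 X3 tX hM FG Tt dF dG big).
apply: (subset_core n2000 nM t1 X3 tX hM GF Tt dG dF).
by rewrite [ltRHS]mulrC.
Qed.
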